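(* Assume: (i) $\mathbb{W}=\mathbb{W}_1\cap\cdots\cap\mathbb{W}_N\ne\emptyset$, so that the problem $\min_{w\in\mathbb{W}}\sum_{k=1}^NJ_k(w)$ is feasible and has a (unique) minimizer $w^\star$; (ii) for each $k$ there are $\lambda_{k,\min},\lambda_{k,\max}>0$ with $\lambda_{k,\min}I_M\le\nabla_w^2J_k(w)\le\lambda_{k,\max}I_M$ for all $w\in\mathbb{R}^M$; (iii) for each $k$ there is $\lambda^p_{k,\max}>0$ with $0\le\nabla_w^2p_k(w)\le\lambda^p_{k,\max}I_M$ for all $w\in\mathbb{R}^M$; (iv) the combination matrix $A$ is primitive and doubly stochastic; (v) the gradient noise satisfies the model described in the context with constants $\alpha\ge0$, $\sigma_v^2\ge0$. Let $0<\theta<1$ and run the penalized diffusion strategy described in the context with step-size $\mu>0$ and penalty parameter $\eta=\mu^{-\theta}$. Then for every $k=1,\dots,N$, $$\lim_{\mu\to0}\limsup_{i\to\infty}\mathbb{E}\|w^\star-\boldsymbol{w}_{k,i}\|^2=0.$$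
   Context: Costs and penalties. There are $N$ agents in a network; $\mathcal{N}_k$ is the neighborhood of agent $k$ (including $k$). Agent $k$ has a twice-differentiable cost $J_k:\mathbb{R}^M\to\mathbb{R}$ and a constraint set $$\mathbb{W}_k=\{w\in\mathbb{R}^M: h_{k,u}(w)=0,\ u=1,\dots,U_k;\ g_{k,l}(w)\le0,\ l=1,\dots,L_k\},$$ with $h_{k,u}$ affine and $g_{k,l}$ convex. The penalty functions are $$p_k(w)=\sum_{l=1}^{L_k}\delta^{\mathrm{IP}}(g_{k,l}(w))+\sum_{u=1}^{U_k}\delta^{\mathrm{EP}}(h_{k,u}(w)),$$ where $\delta^{\mathrm{IP}},\delta^{\mathrm{EP}}:\mathbb{R}\to\mathbb{R}$ are continuous convex functions with $\delta^{\mathrm{IP}}(x)=0$ for $x\le0$, $\delta^{\mathrm{IP}}(x)>0$ for $x>0$, $\delta^{\mathrm{EP}}(0)=0$, $\delta^{\mathrm{EP}}(x)>0$ for $x\neq0$, chosen so that the $p_k$ are twice differentiable and $\nabla_wp_k(w')=0$ whenever $w'\in\mathbb{W}$. Penalized diffusion strategy. Let $A=[a_{\ell k}]$ be an $N\times N$ matrix with nonnegative entries, $a_{\ell k}=0$ if $\ell\notin\mathcal{N}_k$. Let either $(A_1,A_2)=(I_N,A)$ (Adapt-then-Combine) or $(A_1,A_2)=(A,I_N)$ (Combine-then-Adapt), with entries $a_{1,\ell k}$ and $a_{2,\ell k}$. With constant step-size $\mu>0$ and penalty parameter $\eta>0$, starting from initial vectors $\boldsymbol{w}_{k,0}\in\mathbb{R}^M$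 with finite second moments, each agent $k$ iterates, for $i\ge1$, $$\boldsymbol{\phi}_{k,i-1}=\sum_{\ell\in\mathcal{N}_k}a_{1,\ell k}\boldsymbol{w}_{\ell,i-1},\qquad \boldsymbol{\zeta}_{k,i}=\boldsymbol{\phi}_{k,i-1}-\mu\,\widehat{\nabla_w}J_k(\boldsymbol{\phi}_{k,i-1}),$$ $$\boldsymbol{\psi}_{k,i}=\boldsymbol{\zeta}_{k,i}-\mu\eta\,\nabla_wp_k(\boldsymbol{\zeta}_{k,i}),\qquad \boldsymbol{w}_{k,i}=\sum_{\ell\in\mathcal{N}_k}a_{2,\ell k}\boldsymbol{\psi}_{\ell,i}.$$ Gradient noise model. At iteration $i$, $\widehat{\nabla_w}J_k(\boldsymbol{w})=\nabla_wJ_k(\boldsymbol{w})+\boldsymbol{v}_{k,i}(\boldsymbol{w})$, where, with $\mathcal{H}_{i-1}$ denoting the past history of the iterates $\{\boldsymbol{w}_{k,j}:k=1,\dots,N,\ j\le i-1\}$, for every random vector $\boldsymbol{w}$ that is a function of (measurable with respect to) $\mathcal{H}_{i-1}$, $$\mathbb{E}\{\boldsymbol{v}_{k,i}(\boldsymbol{w})\mid\mathcal{H}_{i-1}\}=0,\qquad \mathbb{E}\|\boldsymbol{v}_{k,i}(\boldsymbol{w})\|^2\le\alpha\,\mathbb{E}\|\boldsymbol{w}\|^2+\sigma_v^2,$$ with $\alpha,\sigma_v^2$ not depending on $\mu$. Conventions. A doubly stochastic matrix has nonnegative entries with all row and column sums equal to one; a nonnegative matrix is primitive if some power of it is entrywise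 positive. For symmetric matrices, $X\le Y$ means $Y-X$ is positive semidefinite; $\|\cdot\|$ is the Euclidean norm. *)

(* Defs.v *)
From HB Require Import structures.
From mathcomp Require Import all_boot all_order all_algebra.
From mathcomp Require Import all_classical all_reals all_analysis.

Set Implicit Arguments.
Unset Strict Implicit.
Unset Printing Implicit Defensive.

Import Order.TTheory GRing.Theory Num.Theory.
Import numFieldNormedType.Exports.

Local Open Scope classical_set_scope.
Local Open Scope ring_scope.

Section Calculus.
Context {R : realType} {M : nat}.
Implicit Types (f : 'rV[R]_M -> R) (x : 'rV[R]_M) (X Y : 'M[R]_M).

(* The library norm on 'rV[R]_M is the sup norm, hence this one; both induce
   the same topology and the same notion of differentiability. *)
Definition enorm x : R := Num.sqrt (\sum_(j < M) x 0 j ^+ 2).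

Definition gradient f x : 'rV[R]_M := \row_(j < M) 'D_(delta_mx 0 j) f x.

Definition hessian f x : 'M[R]_M := jacobian (gradient f) x.

Definition twice_differentiable f : Prop :=
  (forall x, differentiable f x) /\ (forall x, differentiable (gradient f) x).

Definition psd X : Prop :=
  X^T = X /\ forall u : 'rV[R]_M, 0 <= (u *m X *m u^T) 0 0.

Definition loewner_le X Y : Prop := psd (Y - X).

Definition affine_function f : Prop :=
  exists (a : 'rV[R]_M) (b : R), forall x, f x = (x *m a^T) 0 0 + b.

End Calculus.

Section Constraints.
Context {R : realType} {M N : nat}.
Variables (U L : 'I_N -> nat).
Variables (h : forall k : 'I_N, 'I_(U k) -> 'rV[R]_M -> R).
Variables (g : forall k : 'I_N, 'I_(L k) -> 'rV[R]_M -> R).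

Definition feasible_set (k : 'I_N) : set 'rV[R]_M :=
  [set w | (forall u : 'I_(U k), h u w = 0) /\
           (forall l : 'I_(L k), g l w <= 0)].

Definition global_feasible_set : set 'rV[R]_M :=
  [set w | forall k : 'I_N, feasible_set k w].

Definition penalty (dIP dEP : R -> R) (k : 'I_N) (w : 'rV[R]_M) : R :=
  \sum_(l < L k) dIP (g l w) + \sum_(u < U k) dEP (h u w).

End Constraints.

Definition inequality_penalty (R : realType) (dIP : R -> R) : Prop :=
  [/\ continuous dIP,
      @convex_function R R^o setT dIP,
      forall x, x <= 0 -> dIP x = 0 &
      forall x, 0 < x -> 0 < dIP x].

Definition equality_penalty (R : realType) (dEP : R -> R) : Prop :=
  [/\ continuous dEP,
      @convex_function R R^o setT dEP,
      dEP 0 = 0 &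
      forall x, x != 0 -> 0 < dEP x].

Definition minimizer_on (T : Type) (R : realType) (f : T -> R) (W : set T)
    (x : T) : Prop :=
  W x /\ forall y, W y -> f x <= f y.

Definition doubly_stochastic (R : realType) (N : nat) (A : 'M[R]_N) : Prop :=
  [/\ forall l k, 0 <= A l k,
      forall l, \sum_(k < N) A l k = 1 &
      forall k, \sum_(l < N) A l k = 1].

Definition primitive_mx (R : realType) (N : nat) (A : 'M[R]_N) : Prop :=
  exists2 m : nat, (0 < m)%N & forall l k, 0 < (A ^+ m) l k.

Section Strategy.
Context {R : realType} {M N : nat}.
Variables (nbr : 'I_N -> {set 'I_N}) (A1 A2 : 'M[R]_N).
Variables (J p : 'I_N -> 'rV[R]_M -> R) (mu eta : R).

Definition combine (A : 'M[R]_N) (x : 'I_N -> 'rV[R]_M) (k : 'I_N)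
    : 'rV[R]_M :=
  \sum_(l in nbr k) A l k *: x l.

Definition diffusion_step (v : 'I_N -> 'rV[R]_M -> 'rV[R]_M)
    (w : 'I_N -> 'rV[R]_M) : 'I_N -> 'rV[R]_M :=
  let phi := combine A1 w in
  let zeta k := phi k - mu *: (gradient (J k) (phi k) + v k (phi k)) in
  let psi k := zeta k - (mu * eta) *: gradient (p k) (zeta k) in
  combine A2 psi.

(* [v i k omega x] is the realization, at time i and agent k, of the noise
   field v_{k,i}(x); the step from time i to time i.+1 uses [v i.+1], so
   [v 0] is never used. *)
Fixpoint diffusion (Omega : Type) (w0 : 'I_N -> Omega -> 'rV[R]_M)
    (v : nat -> 'I_N -> Omega -> 'rV[R]_M -> 'rV[R]_M)
    (i : nat) (k : 'I_N) (omega : Omega) : 'rV[R]_M :=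
  if i is i'.+1 then
    diffusion_step (fun l => v i l omega)
                   (fun l => diffusion w0 v i' l omega) k
  else w0 k omega.

End Strategy.

Section Probability.
Context {d : measure_display} {Omega : measurableType d} {R : realType}.
Context {M N : nat}.
Variable P : probability Omega R.

Definition measurable_wrt (G : set (set Omega)) (X : Omega -> R) : Prop :=
  forall B : set R, measurable B -> G (X @^-1` B).

(* Borel measurability into R^M is measurability of each coordinate. *)
Definition vector_measurable_wrt (G : set (set Omega))
    (X : Omega -> 'rV[R]_M) : Prop :=
  forall j, measurable_wrt G (fun omega => X omega 0 j).

Definition random_vector (X : Omega -> 'rV[R]_M) : Prop :=
  vector_measurable_wrt measurable X.

Definition second_moment (X : Omega -> 'rV[R]_M) : \bar R :=
  'E_P[fun omega => enorm (X omega) ^+ 2].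

(* Y is a version of E(X | G), for a sub-sigma-algebra G *)
Definition is_condexp (G : set (set Omega)) (X Y : Omega -> R) : Prop :=
  [/\ P.-integrable setT (EFin \o X),
      P.-integrable setT (EFin \o Y),
      measurable_wrt G Y &
      forall E, G E ->
        \int[P]_(omega in E) (X omega)%:E = \int[P]_(omega in E) (Y omega)%:E]%E.

Definition integrable_vector (X : Omega -> 'rV[R]_M) : Prop :=
  forall j, P.-integrable setT (EFin \o (fun omega => X omega 0 j)).

Definition is_condexp_vector (G : set (set Omega))
    (X Y : Omega -> 'rV[R]_M) : Prop :=
  forall j, is_condexp G (fun omega => X omega 0 j) (fun omega => Y omega 0 j).

(* sigma-algebra generated by all w_{k,j}, for every agent k and j <= i *)
Definition history (w : nat -> 'I_N -> Omega -> 'rV[R]_M) (i : nat)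
    : set (set Omega) :=
  <<s [set E | exists j (k : 'I_N) c, (j <= i)%N /\
         preimage_set_system setT (fun omega => w j k omega 0 c)
                             (@measurable _ R) E] >>.

(* The conditional expectation is only meaningful when v_{k,i}(x) is
   integrable; by the second moment bound this is the case as soon as
   E||x||^2 is finite. *)
Definition gradient_noise_model (w : nat -> 'I_N -> Omega -> 'rV[R]_M)
    (v : nat -> 'I_N -> Omega -> 'rV[R]_M -> 'rV[R]_M)
    (alpha sigma_v2 : R) : Prop :=
  forall (i : nat) (k : 'I_N) (x : Omega -> 'rV[R]_M),
    vector_measurable_wrt (history w i) x ->
    let vx := fun omega => v i.+1 k omega (x omega) in
    [/\ random_vector vx,
        integrable_vector vx ->
          is_condexp_vector (history w i) vx (fun=> 0) &
        (second_moment vx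
           <= alpha%:E * second_moment x + sigma_v2%:E)%E].

End Probability.

(* Main.v *)
Require Import Defs.
From HB Require Import structures.
From mathcomp Require Import all_boot all_order all_algebra.
From mathcomp Require Import all_classical all_reals all_analysis.
From mathcomp Require Import measurable_realfun ring lra.

Set Implicit Arguments.
Unset Strict Implicit.
Unset Printing Implicit Defensive.

Import Order.TTheory GRing.Theory Num.Theory.
Import numFieldNormedType.Exports.

Local Open Scope classical_set_scope.
Local Open Scope ring_scope.

(* The runs are compared with the noise-free run started at wstar.  Since the
   costs are strongly convex, a noise-free step contracts the sum of squared
   errors by (1 - mu lam)^2; as the noise is orthogonal to the past, the mean
   square distance to the noise-free run is eventually O(mu).  The noise-free run
   stays in a fixed ball around wstar and ends up at almost fixed points x.
   Comparing the energy of x with that of its image gives, with phi the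
   combination of x by A1, that x is almost fixed by the combinations, that
   sum_k p_k(phi_k) = O(mu + 1/eta) and that
   sum_k <grad J_k(phi_k), phi_k - wstar> = O(mu).  In the limit the first property
   is consensus (A is primitive), the second feasibility, and the third forces
   the common value to be wstar by strict convexity; compactness of the ball makes
   this quantitative. *)

(** The penalty step has size mu * eta = mu^(1 - theta), far larger than mu, so it cannot be treated
    as a perturbation of the gradient step. Two facts tame it: while mu * eta * Lp <= 1 it is
    nonexpansive, and it fixes [wstar]. Hence the contraction factor and the ball around [wstar] do
    not depend on eta. The exponent matters only at the end: mu * eta -> 0 removes the displacement
    caused by the penalties, and 1 / eta -> 0 forces feasibility. The natural reference would be the
    fixed point of the noise-free step; the run from [wstar] replaces it, because its increments
    decay geometrically. For a fixed mu they fall below any prescribed power of mu once i is large,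
    which suits a limit taken in i before mu. The combination matrix need not be symmetric, so
    consensus is not measured spectrally; compactness does this work, at the price of a rate for the
    bias. *)

Lemma sum_continuous {R : realType} (T : topologicalType) (I : finType)
  (F : I -> T -> R) : (forall i, continuous (F i)) ->
  continuous (fun x => \sum_i F i x).
Proof. by move=> cF; apply: continuous_big => //; exact: add_continuous. Qed.

(** * Euclidean inner product, Young inequalities and quadratic forms *)

Section DotProduct.
Context {R : realType} {M : nat}.
Implicit Types (x y z u v : 'rV[R]_M) (X Y Q : 'M[R]_M).

Definition dot u v : R := \sum_(j < M) u 0 j * v 0 j.
Definition sqn u : R := dot u u.

Lemma dotE u v : dot u v = (u *m v^T) 0 0.
Proof. by rewrite mxE; apply: eq_bigr => j _; rewrite mxE. Qed.

Lemma dotC u v : dot u v = dot v u.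
Proof. by apply: eq_bigr => j _; rewrite mulrC. Qed.

Lemma dotDl x y z : dot (x + y) z = dot x z + dot y z.
Proof. by rewrite -big_split; apply: eq_bigr => j _; rewrite mxE mulrDl. Qed.

Lemma dotZl c x z : dot (c *: x) z = c * dot x z.
Proof. by rewrite mulr_sumr; apply: eq_bigr => j _; rewrite mxE mulrA. Qed.

Lemma dotNl x z : dot (- x) z = - dot x z.
Proof. by rewrite -scaleN1r dotZl mulN1r. Qed.

Lemma dotBl x y z : dot (x - y) z = dot x z - dot y z.
Proof. by rewrite dotDl dotNl. Qed.

Lemma dotDr x y z : dot x (y + z) = dot x y + dot x z.
Proof. by rewrite dotC dotDl !(dotC x). Qed.

Lemma dotZr c x z : dot x (c *: z) = c * dot x z.
Proof. by rewrite dotC dotZl dotC. Qed.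

Lemma dotNr x z : dot x (- z) = - dot x z.
Proof. by rewrite dotC dotNl dotC. Qed.

Lemma sqnE u : sqn u = \sum_(j < M) u 0 j ^+ 2.
Proof. by apply: eq_bigr => j _; rewrite expr2. Qed.

Lemma sqn_ge0 u : 0 <= sqn u.
Proof. by rewrite sqnE sumr_ge0// => j _; exact: sqr_ge0. Qed.

Lemma enorm_sqr u : enorm u ^+ 2 = sqn u.
Proof. by rewrite /enorm sqr_sqrtr -?sqnE// sqn_ge0. Qed.

Lemma sqn_eq0 u : sqn u = 0 -> u = 0.
Proof.
rewrite sqnE => /eqP; rewrite psumr_eq0; last by move=> j _; exact: sqr_ge0.
move=> /allP u0; apply/rowP => j; rewrite mxE.
by have := u0 j (mem_index_enum _); rewrite /= sqrf_eq0 => /eqP.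
Qed.

Lemma sqn0 : sqn 0 = 0.
Proof. by rewrite /sqn -(scale0r 0) dotZl mul0r. Qed.

Lemma sqnN u : sqn (- u) = sqn u.
Proof. by rewrite /sqn dotNl dotNr opprK. Qed.

Lemma sqnBC x y : sqn (x - y) = sqn (y - x).
Proof. by rewrite -sqnN opprB. Qed.

Lemma sqnZ c u : sqn (c *: u) = c ^+ 2 * sqn u.
Proof. by rewrite /sqn dotZl dotZr mulrA expr2. Qed.

Lemma sqnD x y : sqn (x + y) = sqn x + 2 * dot x y + sqn y.
Proof. by rewrite /sqn dotDl !dotDr (dotC y x); ring. Qed.

Lemma sqnB x y : sqn (x - y) = sqn x - 2 * dot x y + sqn y.
Proof. by rewrite sqnD sqnN dotNr mulrN. Qed.

Lemma sqn_step c x y u :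
  sqn (x - c *: u - y) = sqn (x - y) - 2 * (c * dot (x - y) u) + c ^+ 2 * sqn u.
Proof. by rewrite [x - _ - y]addrAC [LHS]sqnB sqnZ dotZr. Qed.

Lemma dot_young x y : 2 * `|dot x y| <= sqn x + sqn y.
Proof.
have := sqn_ge0 (x + y); have := sqn_ge0 (x - y); rewrite sqnB sqnD => h1 h2.
by case: (ger0P (dot x y)) => _; lra.
Qed.

(** Expansion of the square of t x - y. The free weight keeps the factor of [x] close to one, so
    that a contraction factor survives when a small error [y] is added. *)
Lemma sqnD_young (t : R) x y : 0 < t ->
  sqn (x + y) <= (1 + t) * sqn x + (1 + t^-1) * sqn y.
Proof.
move=> t0; have := sqn_ge0 (t *: x - y).
rewrite sqnB sqnZ dotZl sqnD => h.
have {h} : 0 <= t^-1 * (t ^+ 2 * sqn x - 2 * (t * dot x y) + sqn y).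
  by rewrite mulr_ge0// invr_ge0 ltW.
have -> : t^-1 * (t ^+ 2 * sqn x - 2 * (t * dot x y) + sqn y) =
  t * sqn x - 2 * dot x y + t^-1 * sqn y by field; rewrite gt_eqF.
by lra.
Qed.

Lemma sqnD_le2 x y : sqn (x + y) <= 2 * sqn x + 2 * sqn y.
Proof. by have := sqnD_young x y ltr01; rewrite invr1; lra. Qed.

Lemma sqnB_le2 x y : sqn (x - y) <= 2 * sqn x + 2 * sqn y.
Proof. by rewrite -(sqnN y) sqnD_le2. Qed.

Lemma dot_continuous (T : topologicalType) (F G : T -> 'rV[R]_M) :
  continuous F -> continuous G -> continuous (fun t => dot (F t) (G t)).
Proof.
move=> cF cG; apply: sum_continuous => j t.
have coord (H : T -> 'rV[R]_M) : continuous H -> {for t, continuous (fun s => H s 0 j)}.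
  move=> cH; apply: (@continuous_comp _ _ _ H (fun v : 'rV[R]_M => v 0 j)).
    exact: cH.
  exact: coord_continuous.
by apply: continuousM; exact: coord.
Qed.

Lemma dotl_continuous u : continuous (dot^~ u).
Proof.
apply: dot_continuous; last exact: cst_continuous.
by move=> v; exact: cvg_id.
Qed.

Definition qform X u v : R := (u *m X *m v^T) 0 0.

Lemma qform_scalar c u v : qform c%:M u v = c * dot u v.
Proof. by rewrite /qform mul_mx_scalar -scalemxAl mxE dotE. Qed.

Lemma qformB X Y u v : qform (X - Y) u v = qform X u v - qform Y u v.
Proof. by rewrite /qform mulmxBr mulmxBl !mxE. Qed.

Let qformBl X x y v : qform X (x - y) v = qform X x v - qform X y v.
Proof. by rewrite /qform !mulmxBl !mxE. Qed.

Let qformBr X x y v : qform X v (x - y) = qform X v x - qform X v y.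
Proof. by rewrite /qform linearB /= mulmxBr !mxE. Qed.

Let qformZl X c x v : qform X (c *: x) v = c * qform X x v.
Proof. by rewrite /qform -!scalemxAl mxE. Qed.

Let qformZr X c x v : qform X v (c *: x) = c * qform X v x.
Proof. by rewrite /qform linearZ /= -scalemxAr mxE. Qed.

Lemma qformZ c X u v : qform (c *: X) u v = c * qform X u v.
Proof. by rewrite /qform -scalemxAr -scalemxAl mxE. Qed.

(* Testing positivity of Q on c d - u avoids Cauchy-Schwarz and square roots. *)
Lemma qform_sqn_le Q c d u : 0 < c -> Q^T = Q ->
  (forall z, 0 <= qform Q z z) -> (forall z, qform Q z z <= c * sqn z) ->
  sqn u = qform Q d u -> sqn u <= c ^+ 2 * sqn d.
Proof.
move=> c0 Qsym Q0 Qc uE.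
have QC : qform Q u d = qform Q d u.
  rewrite /qform; transitivity ((d *m Q *m u^T)^T 0 0); last by rewrite mxE.
  by rewrite !trmx_mul trmxK Qsym mulmxA.
have : 0 <= qform Q (c *: d - u) (c *: d - u) by exact: Q0.
have -> : qform Q (c *: d - u) (c *: d - u) =
    c ^+ 2 * qform Q d d - 2 * c * qform Q d u + qform Q u u.
  transitivity (c * c * qform Q d d - c * qform Q d u - c * qform Q u d
                + qform Q u u); last by rewrite QC; ring.
  by rewrite !(qformBl, qformBr, qformZl, qformZr); ring.
rewrite -uE => h.
have h1 := Qc d; have h2 := Qc u.
have h3 : c * sqn u <= c * (c ^+ 2 * sqn d).
  have : c ^+ 2 * qform Q d d <= c ^+ 2 * (c * sqn d).
    by rewrite ler_wpM2l// sqr_ge0.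
  by move=> ?; lra.
by rewrite ler_pM2l in h3.
Qed.

End DotProduct.

(** * Consequences of two-sided Hessian bounds for gradients and gradient steps *)

Section HessianBounds.
Context {R : realType} {M : nat}.
Variable f : 'rV[R]_M -> R.
Hypothesis f2 : twice_differentiable f.
Implicit Types x y z u v : 'rV[R]_M.

Lemma derive_gradient x u : 'D_u f x = dot (gradient f x) u.
Proof.
have df := f2.1 x.
rewrite deriveE// [in LHS](row_sum_delta u) linear_sum /=; apply: eq_bigr => j _.
by rewrite linearZ /= /gradient mxE deriveE// mulrC.
Qed.

Let line x y (t : R) := y + t *: (x - y).

Let is_derive_along (g : 'rV[R]_M -> R) x y (t : R) :
  (forall z, differentiable g z) ->
  is_derive t (1 : R) (g \o line x y) ('D_(x - y) g (line x y t)).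
Proof.
move=> dg.
have shift (s : R) : line x y (s *: 1 + t) = s *: (x - y) + line x y t.
  by rewrite /line scalerDl addrCA [s *: 1]mulr1.
have quotE : (fun s : R => s^-1 *: ((g \o line x y) (s *: 1 + t) - (g \o line x y) t))
    = (fun s => s^-1 *: (g (s *: (x - y) + line x y t) - g (line x y t))).
  by apply/funext => s; rewrite /= shift.
apply: DeriveDef; rewrite /derivable /derive quotE //.
exact: (diff_derivable (dg _)).
Qed.

Let mvt_along (g : 'rV[R]_M -> R) x y :
  (forall z, differentiable g z) ->
  exists2 t : R, 0 < t < 1 & g x - g y = 'D_(x - y) g (line x y t).
Proof.
move=> dg.
have [||t t01] := @MVT R (g \o line x y)
    (fun t => 'D_(x - y) g (line x y t)) 0 1 ltr01.
- by move=> t _; exact: is_derive_along.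
- apply: continuous_subspaceT => t.
  apply: differentiable_continuous; exact: differentiable_comp.
rewrite /= /line scale1r scale0r addr0 subr0 mulr1 [y + (x - y)]addrC subrK => ->.
by exists t => //; move: t01; rewrite in_itv.
Qed.

Lemma mvt_value x y : exists2 t : R, 0 < t < 1 &
  f x - f y = dot (gradient f (y + t *: (x - y))) (x - y).
Proof.
have [t t01 ->] := mvt_along x y f2.1.
by exists t => //; rewrite derive_gradient.
Qed.

(** A vector-valued gradient has no mean value theorem, so the scalar one is applied to its product
    with [u]. The point [z] depends on [u]; this is harmless because [u] will be the very vector
    whose norm is to be bounded. *)
Lemma mvt_gradient x y u :
  exists z, dot (gradient f x - gradient f y) u = qform (hessian f z) (x - y) u.
Proof.
(* The pairing with [u] is packed as a linear map, which is then its own differential. *)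
pose l (v : 'rV[R]_M) : R := dot v u.
have ll : linear l by move=> c v w; rewrite /l dotDl dotZl.
pose L : {linear 'rV[R]_M -> R} :=
  HB.pack l (GRing.isLinear.Build _ _ _ _ l ll).
have cL : continuous L by exact: dotl_continuous.
have dl v : differentiable l v by exact: (linear_differentiable v cL).
have dg z : differentiable (l \o gradient f) z.
  by apply: differentiable_comp => //; exact: f2.2.
have [t _ tE] := mvt_along x y dg.
exists (line x y t).
rewrite dotBl [LHS]tE deriveE// diff_comp//=; last exact: f2.2.
rewrite -[X in 'd X _]/(L : _ -> _) diff_lin//= -deriveE; last exact: f2.2.
rewrite deriveEjacobian; last exact: f2.2.
by rewrite /l dotE.
Qed.

Lemma gradient_continuous : continuous (gradient f).
Proof. by move=> x; apply: differentiable_continuous; exact: f2.2. Qed.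

Lemma twice_differentiable_continuous : continuous f.
Proof. by move=> x; apply: differentiable_continuous; exact: f2.1. Qed.

Variables lo hi : R.
Hypothesis f_hess : forall w, loewner_le lo%:M (hessian f w) /\
  loewner_le (hessian f w) hi%:M.

Let hess_sym w : (hessian f w)^T = hessian f w.
Proof.
have [[+ _] _] := f_hess w.
by rewrite linearB /= tr_scalar_mx => /(can_inj (subrK _)).
Qed.

Let hess_lo w u : lo * sqn u <= qform (hessian f w) u u.
Proof.
have [[_ H] _] := f_hess w.
have : 0 <= qform (hessian f w - lo%:M) u u := H u.
by rewrite qformB qform_scalar subr_ge0.
Qed.

Let hess_hi w u : qform (hessian f w) u u <= hi * sqn u.
Proof.
have [_ [_ H]] := f_hess w.
have : 0 <= qform (hi%:M - hessian f w) u u := H u.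
by rewrite qformB qform_scalar subr_ge0.
Qed.

Lemma gradient_monotone x y :
  lo * sqn (x - y) <= dot (gradient f x - gradient f y) (x - y).
Proof. by have [z ->] := mvt_gradient x y (x - y); exact: hess_lo. Qed.

Lemma gradient_lipschitz x y : 0 <= lo -> 0 < hi ->
  sqn (gradient f x - gradient f y) <= hi ^+ 2 * sqn (x - y).
Proof.
move=> lo0 hi0; set u := gradient f x - gradient f y.
have [z zE] := mvt_gradient x y u.
apply: (@qform_sqn_le _ _ (hessian f z)) => // v.
by apply: le_trans (hess_lo z v); rewrite mulr_ge0// sqn_ge0.
Qed.

(** The difference of the two images is Q (x - y) with Q = I - s H, tested against itself. The
    condition on [hi] makes Q positive semidefinite, and the one on [lo] bounds it by 1 - s lo >
    0. *)
Lemma gradient_step_contraction (s : R) x y :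
  0 <= s -> s * hi <= 1 -> s * lo < 1 ->
  sqn ((x - s *: gradient f x) - (y - s *: gradient f y))
    <= (1 - s * lo) ^+ 2 * sqn (x - y).
Proof.
move=> s0 shi slo; set u := (X in sqn X).
have uE : u = (x - y) - s *: (gradient f x - gradient f y).
  by rewrite /u scalerBr; apply/rowP => j; rewrite !mxE; ring.
have [z zE] := mvt_gradient x y u.
apply: (@qform_sqn_le _ _ (1%:M - s *: hessian f z)).
- by rewrite subr_gt0.
- by rewrite linearB linearZ /= tr_scalar_mx hess_sym.
- move=> v; rewrite qformB qformZ qform_scalar mul1r subr_ge0 -/(sqn v).
  have := sqn_ge0 v; have := hess_hi z v => h1 h2.
  have : s * qform (hessian f z) v v <= s * (hi * sqn v) by rewrite ler_wpM2l.
  have : s * hi * sqn v <= 1 * sqn v by rewrite ler_wpM2r.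
  by lra.
- move=> v; rewrite qformB qformZ qform_scalar mul1r -/(sqn v).
  have : s * (lo * sqn v) <= s * qform (hessian f z) v v by rewrite ler_wpM2l.
  by lra.
- by rewrite qformB qformZ qform_scalar mul1r -zE -dotZl -dotBl -uE.
Qed.

(** By the mean value theorem the increment is the slope at an intermediate point z; since x - z is
    a positive multiple of x - y, monotonicity of the gradient compares that slope with the one at
    [x]. *)
Lemma convex_gradient_ineq x y : 0 <= lo -> f x - f y <= dot (gradient f x) (x - y).
Proof.
move=> lo0; have [t /andP[t0 t1] ->] := mvt_value x y.
rewrite -subr_ge0 -dotBl; set z := y + _.
have xz : x - z = (1 - t) *: (x - y).
  by rewrite /z opprD addrA scalerBl scale1r.
have t10 : 0 < 1 - t by rewrite subr_gt0.
have := gradient_monotone x z; rewrite xz dotZr sqnZ => h.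
rewrite -(pmulr_rge0 _ t10); apply: le_trans h.
by rewrite mulr_ge0// mulr_ge0 ?sqr_ge0 ?sqn_ge0.
Qed.

Lemma strictly_convex_gradient_ineq x y : 0 < lo -> x != y ->
  f x - f y < dot (gradient f x) (x - y).
Proof.
move=> lo0 xy; have [t /andP[t0 t1] ->] := mvt_value x y.
rewrite -subr_gt0 -dotBl; set z := y + _.
have xz : x - z = (1 - t) *: (x - y).
  by rewrite /z opprD addrA scalerBl scale1r.
have t10 : 0 < 1 - t by rewrite subr_gt0.
have := gradient_monotone x z; rewrite xz dotZr sqnZ => h.
rewrite -(pmulr_rgt0 _ t10); apply: lt_le_trans h.
rewrite mulr_gt0// mulr_gt0 ?exprn_gt0// lt_neqAle sqn_ge0 andbT eq_sym.
by apply: contra xy => /eqP/sqn_eq0/eqP; rewrite subr_eq0.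
Qed.

(* Nonexpansiveness of the step 2 s is exactly the cocoercivity of the gradient
   at a critical point. *)
Lemma convex_step_descent (s : R) x y :
  0 <= lo -> 0 <= s -> 2 * s * hi <= 1 -> 2 * s * lo < 1 ->
  gradient f y = 0 ->
  sqn (x - s *: gradient f x - y) <= sqn (x - y) - s * (f x - f y).
Proof.
move=> lo0 s0 shi slo gy.
have s20 : 0 <= 2 * s by rewrite mulr_ge0.
have := gradient_step_contraction x y s20 shi slo.
rewrite gy scaler0 subr0 => h.
have {h} : sqn (x - (2 * s) *: gradient f x - y) <= sqn (x - y).
  apply: (le_trans h); rewrite ler_piMl ?sqn_ge0// expr_le1//.
    by rewrite gerBl mulr_ge0.
  by rewrite subr_ge0 ltW.
(* Expanding the step 2 s gives s^2 |grad f x|^2 <= s <x - y, grad f x>. So the step s loses at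
   least s <x - y, grad f x>, which convexity bounds below by s (f x - f y). *)
rewrite !sqn_step => h.
have h2 := convex_gradient_ineq x y lo0.
rewrite dotC in h2.
have h3 : s * (f x - f y) <= s * dot (x - y) (gradient f x) by rewrite ler_wpM2l.
by rewrite exprMn in h; lra.
Qed.

End HessianBounds.

(** * Combination as a matrix action on the family of agent vectors *)

Section Network.
Context {R : realType} {M N : nat}.
Implicit Types (x y : 'I_N -> 'rV[R]_M) (A B : 'M[R]_N).

Definition energy x : R := \sum_k sqn (x k).

Definition mix B x : 'I_N -> 'rV[R]_M := fun k => \sum_l B l k *: x l.

Lemma energy_ge0 x : 0 <= energy x.
Proof. by apply: sumr_ge0 => k _; exact: sqn_ge0. Qed.

Lemma sqn_le_energy x k : sqn (x k) <= energy x.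
Proof.
by rewrite /energy (bigD1 k)//= lerDl sumr_ge0// => l _; exact: sqn_ge0.
Qed.

Lemma energyBC x y : energy (x - y) = energy (y - x).
Proof. by apply: eq_bigr => k _; exact: sqnBC. Qed.

Lemma energyD_young (t : R) x y : 0 < t ->
  energy (x + y) <= (1 + t) * energy x + (1 + t^-1) * energy y.
Proof.
move=> t0; rewrite !mulr_sumr -big_split; apply: ler_sum => k _.
exact: sqnD_young.
Qed.

Lemma energyD_le2 x y : energy (x + y) <= 2 * energy x + 2 * energy y.
Proof. by have := energyD_young x y ltr01; rewrite invr1. Qed.

Lemma mixB B x y : mix B (x - y) = mix B x - mix B y.
Proof.
apply/funext => k; rewrite /mix [RHS]/= -[RHS]sumrB.
by apply: eq_bigr => l _; rewrite scalerBr.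
Qed.

(** The factors are reversed because agent k reads its weights in column k. *)
Lemma mix_mul A B x : mix A (mix B x) = mix (B *m A) x.
Proof.
apply/funext => k; rewrite /mix.
under eq_bigr do rewrite scaler_sumr.
rewrite exchange_big; apply: eq_bigr => j _ /=.
rewrite mxE scaler_suml; apply: eq_bigr => l _.
by rewrite scalerA mulrC.
Qed.

Lemma mix1 x : mix 1%:M x = x.
Proof.
apply/funext => k; rewrite /mix (bigD1 k)//= mxE eqxx scale1r big1 ?addr0// => l lk.
by rewrite mxE (negbTE lk) scale0r.
Qed.

Lemma mix_cst B (w : 'rV[R]_M) : (forall k, \sum_l B l k = 1) ->
  mix B (cst w) = cst w.
Proof. by move=> B1; apply/funext => k; rewrite /mix -scaler_suml B1 scale1r. Qed.

Lemma combineE (nbr : 'I_N -> {set 'I_N}) B x :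
  (forall l k, l \notin nbr k -> B l k = 0) -> combine nbr B x = mix B x.
Proof.
move=> B0; apply/funext => k; rewrite /combine /mix big_mkcond.
by apply: eq_bigr => l _; case: ifPn => // /B0 ->; rewrite scale0r.
Qed.

Lemma doubly_stochastic1 : doubly_stochastic (1%:M : 'M[R]_N).
Proof.
split=> [l k|l|k]; first by rewrite mxE ler0n.
  rewrite (bigD1 l)//= big1 ?addr0 ?mxE ?eqxx// => k kl.
  by rewrite mxE eq_sym (negbTE kl).
rewrite (bigD1 k)//= big1 ?addr0 ?mxE ?eqxx// => l lk.
by rewrite mxE (negbTE lk).
Qed.

Lemma dot_mixl B x k v : dot (mix B x k) v = \sum_l B l k * dot (x l) v.
Proof.
rewrite /mix; elim/big_rec2: _ => [|l c u _ <-]; last by rewrite dotDl dotZl.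
by rewrite -(scale0r 0) dotZl mul0r.
Qed.

(** Jensen's inequality; the gap between the two sides is the weighted variance of the [x l] around
    their mean [m]. *)
Lemma sqn_mix_le B x k : (forall l k, 0 <= B l k) -> (forall k, \sum_l B l k = 1) ->
  sqn (mix B x k) <= \sum_l B l k * sqn (x l).
Proof.
move=> B0 B1; set m := mix B x k.
have : 0 <= \sum_l B l k * sqn (x l - m).
  by apply: sumr_ge0 => l _; rewrite mulr_ge0// sqn_ge0.
rewrite -[sqn m <= _]subr_ge0; congr (0 <= _).
under eq_bigr do rewrite sqnB mulrDr mulrBr.
rewrite big_split sumrB /= -mulr_suml B1 mul1r.
suff -> : \sum_l B l k * (2 * dot (x l) m) = 2 * sqn m by ring.
have -> : sqn m = \sum_l B l k * dot (x l) m by rewrite -dot_mixl.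
by rewrite mulr_sumr; apply: eq_bigr => l _; rewrite mulrCA.
Qed.

(** Column sums make each combination an average, and row sums make every agent count once after the
    sums are exchanged. *)
Lemma energy_mix_le B x : doubly_stochastic B -> energy (mix B x) <= energy x.
Proof.
move=> [B0 Br Bc]; apply: (@le_trans _ _ (\sum_k \sum_l B l k * sqn (x l))).
  by apply: ler_sum => k _; exact: sqn_mix_le.
rewrite exchange_big /=; apply: ler_sum => l _.
by rewrite -mulr_suml Br mul1r.
Qed.

(** Maximum principle: [x] is also fixed by a power of [A] with positive entries. In each
    coordinate, an agent with the largest value is then an average of all agents with positive
    weights, so all of them share its value. *)
Lemma primitive_fixed_consensus A x : primitive_mx A ->
  (forall l k, 0 <= A l k) -> (forall k, \sum_l A l k = 1) ->
  mix A x = x -> forall k l, x k = x l.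
Proof.
move=> [m m0 Am] A0 A1 Ax.
have Amx : mix (A ^+ m) x = x.
  elim: m {m0 Am} => [|m IH]; first by rewrite expr0 -[1]/(1%:M) mix1.
  by rewrite exprSr -[_ * A]/(_ *m A) -mix_mul IH.
have Am1 k : \sum_l (A ^+ m) l k = 1.
  elim: m {m0 Am Amx} k => [|m IH] k.
    by rewrite expr0; have [_ _ ->] := doubly_stochastic1.
  rewrite exprSr; under eq_bigr do rewrite mxE.
  rewrite exchange_big /= -[RHS](A1 k); apply: eq_bigr => j _.
  by rewrite -mulr_suml IH mul1r.
move=> k0 l0; apply/rowP => c.
have [i _ imax] := @Order.TotalTheory.arg_maxP _ _ _ k0 xpredT (fun k => x k 0 c) isT.
suff xi l : x l 0 c = x i 0 c by rewrite !xi.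
have /eqP : \sum_l (A ^+ m) l i * (x i 0 c - x l 0 c) = 0.
  under eq_bigr do rewrite mulrBr.
  rewrite sumrB -mulr_suml Am1 mul1r.
  suff <- : x i 0 c = \sum_l (A ^+ m) l i * x l 0 c by rewrite subrr.
  by rewrite -[in LHS]Amx /mix summxE; apply: eq_bigr => j _; rewrite mxE.
rewrite psumr_eq0; last first.
  by move=> j _; apply: mulr_ge0; [exact: ltW|rewrite subr_ge0; exact: imax].
move=> /allP /(_ l (mem_index_enum _)) /=.
by rewrite mulf_eq0 gt_eqF//= subr_eq0 => /eqP.
Qed.

End Network.

(** * The noise-free step: contraction, bounded runs and almost fixed points *)

Section NoiseFree.
Context {R : realType} {M N : nat}.
Variables (A1 A2 : 'M[R]_N) (J p : 'I_N -> 'rV[R]_M -> R).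
Variables (lam L Lp : R) (wstar : 'rV[R]_M).
Hypotheses (A1_ds : doubly_stochastic A1) (A2_ds : doubly_stochastic A2).
Hypotheses (lam_gt0 : 0 < lam) (L_gt0 : 0 < L) (Lp_gt0 : 0 < Lp).
Hypothesis J_diff2 : forall k, twice_differentiable (J k).
Hypothesis p_diff2 : forall k, twice_differentiable (p k).
Hypothesis J_hess : forall k w, loewner_le lam%:M (hessian (J k) w) /\
  loewner_le (hessian (J k) w) L%:M.
Hypothesis p_hess : forall k w, loewner_le 0%:M (hessian (p k) w) /\
  loewner_le (hessian (p k) w) Lp%:M.
Hypothesis p_grad0 : forall k, gradient (p k) wstar = 0.
Hypothesis p_wstar : forall k, p k wstar = 0.
Implicit Types (x y n : 'I_N -> 'rV[R]_M) (mu s : R).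

Definition gradient_step mu k (z : 'rV[R]_M) := z - mu *: gradient (J k) z.
Definition penalty_step s k (z : 'rV[R]_M) := z - s *: gradient (p k) z.

(** Both orders of combination are covered by two matrices; [s] stands for mu * eta and [n k] for
    the realized noise of agent k. *)
Definition noisy_step mu s n x : 'I_N -> 'rV[R]_M :=
  mix A2 (fun k => penalty_step s k (gradient_step mu k (mix A1 x k) - mu *: n k)).

Definition noise_free_step mu s x : 'I_N -> 'rV[R]_M :=
  mix A2 (fun k => penalty_step s k (gradient_step mu k (mix A1 x k))).

Definition noise_free_run mu s i := iter i (noise_free_step mu s) (cst wstar).

(** The single gradients do not vanish at [wstar] in general; this residual is what moves [wstar]
    under the noise-free step and fixes the radius of the ball. *)
Definition J_residual : R := \sum_k sqn (gradient (J k) wstar).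

Lemma J_residual_ge0 : 0 <= J_residual.
Proof. by apply: sumr_ge0 => k _; exact: sqn_ge0. Qed.

Let A1_cst : mix A1 (cst wstar) = cst wstar.
Proof. by apply: mix_cst; case: A1_ds. Qed.

Let A2_cst : mix A2 (cst wstar) = cst wstar.
Proof. by apply: mix_cst; case: A2_ds. Qed.

Lemma penalty_step_nonexpansive s k (z z' : 'rV[R]_M) : 0 <= s -> s * Lp <= 1 ->
  sqn (penalty_step s k z - penalty_step s k z') <= sqn (z - z').
Proof.
move=> s0 sLp; have := @gradient_step_contraction _ _ _ (p_diff2 k) _ _ (p_hess k)
  s z z' s0 sLp.
by rewrite mulr0 subr0 expr1n mul1r; apply; exact: ltr01.
Qed.

Lemma gradient_step_energy mu x y : 0 <= mu -> mu * L <= 1 -> mu * lam < 1 ->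
  energy (fun k => gradient_step mu k (mix A1 x k) - gradient_step mu k (mix A1 y k))
    <= (1 - mu * lam) ^+ 2 * energy (x - y).
Proof.
move=> mu0 muL mulam.
apply: (@le_trans _ _ ((1 - mu * lam) ^+ 2 * energy (mix A1 (x - y)))).
  rewrite mulr_sumr; apply: ler_sum => k _; rewrite mixB.
  exact: (gradient_step_contraction (J_diff2 k) (J_hess k)).
by rewrite ler_wpM2l ?sqr_ge0// energy_mix_le.
Qed.

(** The penalty step and the second combination are nonexpansive, so the error is controlled by its
    value after the gradient stage, where the noise still enters additively. *)
Lemma noisy_step_le mu s n x y : 0 <= s -> s * Lp <= 1 ->
  energy (noisy_step mu s n x - noise_free_step mu s y) <=
  energy (fun k => (gradient_step mu k (mix A1 x k) - gradient_step mu k (mix A1 y k))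
                   - mu *: n k).
Proof.
move=> s0 sLp; rewrite -mixB; apply: (le_trans (energy_mix_le _ A2_ds)).
apply: ler_sum => k _; apply: (le_trans (penalty_step_nonexpansive _ _ _ s0 sLp)).
by rewrite addrAC.
Qed.

Lemma noise_free_step_contraction mu s x y :
  0 <= mu -> mu * L <= 1 -> mu * lam < 1 -> 0 <= s -> s * Lp <= 1 ->
  energy (noise_free_step mu s x - noise_free_step mu s y)
    <= (1 - mu * lam) ^+ 2 * energy (x - y).
Proof.
move=> mu0 muL mulam s0 sLp; apply: le_trans (gradient_step_energy _ _ mu0 muL mulam).
rewrite -mixB; apply: (le_trans (energy_mix_le _ A2_ds)).
by apply: ler_sum => k _; exact: penalty_step_nonexpansive.
Qed.

(** Both combinations and the penalty step fix [wstar], so only the gradient step displaces it. The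
    bound therefore contains mu and not the larger [s]. *)
Lemma noise_free_step_wstar mu s : 0 <= s -> s * Lp <= 1 ->
  energy (noise_free_step mu s (cst wstar) - cst wstar) <= mu ^+ 2 * J_residual.
Proof.
move=> s0 sLp; rewrite -[X in _ - X]A2_cst -mixB.
apply: (le_trans (energy_mix_le _ A2_ds)).
rewrite mulr_sumr; apply: ler_sum => k _; rewrite A1_cst.
have e : penalty_step s k wstar = wstar by rewrite /penalty_step p_grad0 scaler0 subr0.
rewrite [in leLHS]/= -[X in sqn (_ - X)]e.
apply: (le_trans (penalty_step_nonexpansive _ _ _ s0 sLp)).
by rewrite /gradient_step addrAC subrr add0r sqnN sqnZ.
Qed.

(** Young's inequality with weight mu lam splits the next error into a contracted part, at most (1 -
    mu lam) B, and the displacement of [wstar]. The value of B is the one for which the second part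
    is at most mu lam B. *)
Lemma noise_free_run_bounded mu s i :
  0 < mu -> mu * L <= 1 -> mu * lam < 1 -> 0 <= s -> s * Lp <= 1 ->
  energy (noise_free_run mu s i - cst wstar) <= 2 * J_residual / lam ^+ 2.
Proof.
move=> mu0 muL mulam s0 sLp; have muge0 := ltW mu0.
have b0 := J_residual_ge0; set B := (X in _ <= X).
have B0 : 0 <= B by apply: divr_ge0; [exact: mulr_ge0|exact: sqr_ge0].
have ml0 : 0 < mu * lam by rewrite mulr_gt0.
elim: i => [|i IH]; first by rewrite /noise_free_run /= subrr /energy big1// => k _; exact: sqn0.
set y := noise_free_run mu s i in IH *.
rewrite -[noise_free_run mu s i.+1]/(noise_free_step mu s y).
set c : 'I_N -> 'rV[R]_M := cst wstar in IH *.
rewrite -(subrKA (noise_free_step mu s c)).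
apply: (le_trans (energyD_young _ _ ml0)).
have h1 := noise_free_step_contraction y c muge0 muL mulam s0 sLp.
have h2 := noise_free_step_wstar mu s0 sLp.
have h3 : (1 + mu * lam) * ((1 - mu * lam) ^+ 2 * energy (y - c)) <= (1 - mu * lam) * B.
  have -> : (1 + mu * lam) * ((1 - mu * lam) ^+ 2 * energy (y - c)) =
    (1 - mu * lam) * ((1 - (mu * lam) ^+ 2) * energy (y - c)) by ring.
  apply: ler_wpM2l; first by rewrite subr_ge0 ltW.
  apply: le_trans IH.
  by rewrite ler_piMl ?energy_ge0// gerBl sqr_ge0.
have h4 : (1 + (mu * lam)^-1) * (mu ^+ 2 * J_residual) <= mu * lam * B.
  have -> : mu * lam * B = 2 * (mu * lam)^-1 * (mu ^+ 2 * J_residual).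
    by rewrite /B; field; rewrite !gt_eqF.
  rewrite ler_wpM2r ?mulr_ge0 ?sqr_ge0//.
  have : 1 <= (mu * lam)^-1 by rewrite invf_ge1// ltW.
  by lra.
have h5 : (1 + mu * lam) * energy (noise_free_step mu s y - noise_free_step mu s c) <=
   (1 + mu * lam) * ((1 - mu * lam) ^+ 2 * energy (y - c)).
  by rewrite ler_wpM2l// addr_ge0// ltW.
have h6 : (1 + (mu * lam)^-1) * energy (noise_free_step mu s c - c) <=
    (1 + (mu * lam)^-1) * (mu ^+ 2 * J_residual).
  by rewrite ler_wpM2l// addr_ge0// invr_ge0 ltW.
by lra.
Qed.

Lemma noise_free_run_gap mu s i :
  0 < mu -> mu * L <= 1 -> mu * lam < 1 -> 0 <= s -> s * Lp <= 1 ->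
  energy (noise_free_step mu s (noise_free_run mu s i) - noise_free_run mu s i) <=
    (1 - mu * lam) ^+ i * (mu ^+ 2 * J_residual).
Proof.
move=> mu0 muL mulam s0 sLp.
have ml0 : 0 < mu * lam by rewrite mulr_gt0.
elim: i => [|i IH]; first by rewrite expr0 mul1r noise_free_step_wstar.
apply: (le_trans (noise_free_step_contraction _ _ (ltW mu0) muL mulam s0 sLp)).
rewrite [in leRHS]exprS -mulrA expr2 -mulrA; apply: ler_wpM2l; first by rewrite subr_ge0 ltW.
by apply: le_trans IH; rewrite ler_piMl ?energy_ge0// gerBl ltW.
Qed.

(* The dissipation energy x - energy (mix A1 x) cannot replace the disagreement:
   A * A^T may be reducible although A is primitive. *)
Definition disagreement x : R := energy (x - mix A2 (mix A1 x)).

Definition violation x : R := \sum_k p k (mix A1 x k).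

(** The gradient stage changes the squared distance to [wstar] by -2 mu times this quantity, up to
    order mu^2. *)
Definition slope x : R :=
  \sum_k dot (gradient (J k) (mix A1 x k)) (mix A1 x k - wstar).

Hypothesis p_ge0 : forall k z, 0 <= p k z.

Section ApproximateFixedPoint.
Variables (B mu eta : R) (x : 'I_N -> 'rV[R]_M).
Hypotheses (B_ge0 : 0 <= B) (mu_gt0 : 0 < mu) (eta_gt0 : 0 < eta).
Hypotheses (mu_le1 : mu <= 1) (muL_le1 : mu * L <= 1).
Hypothesis muetaLp_le1 : 2 * (mu * eta) * Lp <= 1.
Hypothesis x_bounded : energy (x - cst wstar) <= B.
Hypothesis x_almost_fixed : energy (noise_free_step mu (mu * eta) x - x) <= mu ^+ 4.

Let phi := mix A1 x.
Let zeta k := gradient_step mu k (phi k).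
(** Bounds the sum of squared gradients on the ball: each gradient is compared with its value at
    [wstar] by the Lipschitz estimate. *)
Let G := 2 * L ^+ 2 * B + 2 * J_residual.
Let gradsum := \sum_k sqn (gradient (J k) (phi k)).

Let phi_dist : energy (phi - cst wstar) <= energy (x - cst wstar).
Proof. by rewrite -[X in energy (phi - X)]A1_cst -mixB energy_mix_le. Qed.

Let phi_bounded : energy (phi - cst wstar) <= B.
Proof. exact: le_trans phi_dist x_bounded. Qed.

Let G_ge0 : 0 <= G.
Proof. by rewrite addr_ge0 ?mulr_ge0 ?sqr_ge0 ?J_residual_ge0//; exact: ltW. Qed.

Let gradsum_le : gradsum <= G.
Proof.
have L2 : 0 <= 2 * L ^+ 2 by rewrite mulr_ge0// sqr_ge0.
apply: (@le_trans _ _ (2 * L ^+ 2 * energy (phi - cst wstar) + 2 * J_residual)).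
  rewrite !mulr_sumr -big_split; apply: ler_sum => k _ /=.
  rewrite -[X in sqn X](subrK (gradient (J k) wstar)).
  apply: (le_trans (sqnD_le2 _ _)); rewrite lerD2r -mulrA ler_wpM2l//.
  exact: (gradient_lipschitz (J_diff2 k) (J_hess k) _ _ (ltW lam_gt0) L_gt0).
by rewrite lerD2r ler_wpM2l.
Qed.

(** The slope has no sign in general, so it could offset the penalty term in [energy_drop]; this
    lower bound limits how much. *)
Let slope_ge : - (G + B) <= 2 * slope x.
Proof.
have : 2 * - slope x <= gradsum + energy (phi - cst wstar).
  rewrite /slope -sumrN mulr_sumr -big_split; apply: ler_sum => k _ /=.
  apply: le_trans (dot_young _ _); rewrite ler_wpM2l// -normrN ler_norm//.
by have := gradsum_le; have := phi_bounded; lra.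
Qed.

(** [h1] bounds the energy after the step, and [h2] returns to [x] through Young's inequality with
    weight mu^2. The inverse weight costs mu^(-2), so the tolerance mu^4 is what leaves an error of
    order mu^2. *)
Let energy_drop :
  2 * mu * slope x + mu * eta * \sum_k p k (zeta k) <= mu ^+ 2 * (2 * B + 4 + G).
Proof.
have xT := x_almost_fixed; set T := noise_free_step mu (mu * eta) x in xT *.
have s0 : 0 <= mu * eta by rewrite mulr_ge0// ltW.
have mu2 : 0 < mu ^+ 2 by rewrite exprn_gt0.
have mu4 : mu ^+ 4 <= 1 by rewrite exprn_ile1// ltW.
have h1 : energy (T - cst wstar) <= energy (x - cst wstar)
    - 2 * mu * slope x + mu ^+ 2 * G - mu * eta * \sum_k p k (zeta k).
  apply: (@le_trans _ _ (energy (phi - cst wstar) - 2 * mu * slope x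
      + mu ^+ 2 * gradsum - mu * eta * \sum_k p k (zeta k))); last first.
    have : mu ^+ 2 * gradsum <= mu ^+ 2 * G by rewrite ler_wpM2l// ltW.
    by have := phi_dist; lra.
  rewrite -[X in energy (T - X)]A2_cst -mixB; apply: (le_trans (energy_mix_le _ A2_ds)).
  rewrite /slope !mulr_sumr -!sumrN -!big_split; apply: ler_sum => k _ /=.
  have sL : 2 * (mu * eta) * 0 < 1 by rewrite mulr0.
  have := convex_step_descent (p_diff2 k) (p_hess k) (zeta k) (lexx 0) s0 muetaLp_le1 sL (p_grad0 k).
  rewrite p_wstar subr0 => h; apply: (le_trans h); rewrite lerD2r.
  by rewrite /zeta /gradient_step sqn_step (dotC (phi k - wstar)) mulrA.
have h2 : energy (x - cst wstar) <=
    (1 + mu ^+ 2) * energy (T - cst wstar) + (1 + (mu ^+ 2)^-1) * mu ^+ 4.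
  have -> : x - cst wstar = (T - cst wstar) + (x - T) by rewrite [RHS]addrC subrKA.
  apply: (le_trans (energyD_young _ _ mu2)); rewrite lerD2l energyBC.
  by rewrite ler_wpM2l// addr_ge0// invr_ge0 ltW.
have h3 : energy (T - cst wstar) <= 2 + 2 * B.
  have -> : T - cst wstar = (T - x) + (x - cst wstar) by rewrite subrKA.
  apply: (le_trans (energyD_le2 _ _)).
  by move: xT mu4 x_bounded; lra.
have h4 : (1 + (mu ^+ 2)^-1) * mu ^+ 4 <= 2 * mu ^+ 2.
  have -> : (1 + (mu ^+ 2)^-1) * mu ^+ 4 = (mu ^+ 2 + 1) * mu ^+ 2.
    by field; rewrite gt_eqF.
  rewrite ler_wpM2r ?(ltW mu2)//.
  have : mu ^+ 2 <= 1 by rewrite exprn_ile1// ltW.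
  by lra.
have h5 : mu ^+ 2 * energy (T - cst wstar) <= mu ^+ 2 * (2 + 2 * B).
  by rewrite ler_wpM2l// ltW.
by lra.
Qed.

Let psum_ge0 : 0 <= \sum_k p k (zeta k).
Proof. exact: sumr_ge0. Qed.

Lemma slope_le : 2 * slope x <= mu * (2 * B + 4 + G).
Proof.
rewrite -(ler_pM2l mu_gt0).
have : 0 <= mu * eta * \sum_k p k (zeta k) by rewrite !mulr_ge0// ltW.
by have := energy_drop; rewrite expr2; lra.
Qed.

(** With the slope bounded below, [energy_drop] bounds eta times the penalties at [zeta]. Returning
    from [zeta] to [phi] costs only order mu, by convexity of the penalties. *)
Lemma violation_le :
  violation x <= eta^-1 * (3 * B + 4 + 2 * G) + mu * (Lp ^+ 2 * B + G).
Proof.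
have h1 : eta * \sum_k p k (zeta k) <= 3 * B + 4 + 2 * G.
  rewrite -(ler_pM2l mu_gt0).
  have : mu * (mu * (2 * B + 4 + G)) <= mu * (1 * (2 * B + 4 + G)).
    rewrite ler_wpM2l ?(ltW mu_gt0)// ler_wpM2r//.
    by have := G_ge0; have := B_ge0; lra.
  have : mu * - (G + B) <= mu * (2 * slope x) by rewrite ler_wpM2l// ltW.
  by have := energy_drop; rewrite expr2; lra.
have h2 : violation x <= \sum_k p k (zeta k) + mu * (Lp ^+ 2 * B + G).
  apply: (@le_trans _ _ (\sum_k p k (zeta k) +
     mu * (Lp ^+ 2 * energy (phi - cst wstar) + gradsum))); last first.
    by rewrite lerD2l ler_wpM2l ?(ltW mu_gt0)// lerD// ler_wpM2l// sqr_ge0.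
  rewrite mulrDr !mulr_sumr -!big_split; apply: ler_sum => k _ /=.
  have := convex_gradient_ineq (p_diff2 k) (p_hess k) (phi k) (zeta k) (lexx 0).
  rewrite {3}/zeta /gradient_step opprB addrCA subrr addr0 dotZr => h.
  have := gradient_lipschitz (p_diff2 k) (p_hess k) (phi k) wstar (lexx 0) Lp_gt0.
  rewrite p_grad0 subr0 => h3.
  have h4 := dot_young (gradient (p k) (phi k)) (gradient (J k) (phi k)).
  have h5 := ler_norm (dot (gradient (p k) (phi k)) (gradient (J k) (phi k))).
  have h6 := sqn_ge0 (gradient (p k) (phi k)).
  have h7 := sqn_ge0 (gradient (J k) (phi k)).
  have : mu * dot (gradient (p k) (phi k)) (gradient (J k) (phi k)) <=
     mu * (Lp ^+ 2 * sqn (phi k - wstar) + sqn (gradient (J k) (phi k))).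
    by rewrite ler_wpM2l ?(ltW mu_gt0)//; lra.
  by rewrite mulrDr; lra.
apply: (le_trans h2); rewrite lerD2r -(ler_pM2l eta_gt0) mulVKf ?gt_eqF//.
Qed.

(** The image of [x] differs from its pure combination only by the two descent steps, of sizes mu
    and mu * eta. The penalty gradient stays bounded because it is Lipschitz and vanishes at
    [wstar]. *)
Lemma disagreement_le : disagreement x <=
  2 * mu ^+ 4 + 4 * mu ^+ 2 * G
  + 4 * (mu * eta) ^+ 2 * Lp ^+ 2 * (2 * B + 2 * mu ^+ 2 * G).
Proof.
have xT := x_almost_fixed; set T := noise_free_step mu (mu * eta) x in xT.
have d1 : energy (T - mix A2 (mix A1 x)) <= 2 * mu ^+ 2 * G
    + 2 * (mu * eta) ^+ 2 * Lp ^+ 2 * (2 * B + 2 * mu ^+ 2 * G).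
  apply: (@le_trans _ _ (2 * mu ^+ 2 * gradsum + 2 * (mu * eta) ^+ 2 * Lp ^+ 2 *
      (2 * energy (phi - cst wstar) + 2 * mu ^+ 2 * gradsum))); last first.
    have m2 : 0 <= 2 * mu ^+ 2 by rewrite mulr_ge0// sqr_ge0.
    apply: lerD; first by rewrite ler_wpM2l.
    apply: ler_wpM2l; first by rewrite !mulr_ge0// ?sqr_ge0 ?ltW// mulr_ge0 ?ltW.
    by apply: lerD; rewrite ler_wpM2l.
  rewrite -mixB; apply: (le_trans (energy_mix_le _ A2_ds)).
  rewrite mulrDr !mulr_sumr -!big_split; apply: ler_sum => k _ /=.
  rewrite -[leLHS]/(sqn (penalty_step (mu * eta) k (zeta k) - phi k)).
  have -> : penalty_step (mu * eta) k (zeta k) - phi k =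
     - (mu *: gradient (J k) (phi k)) - (mu * eta) *: gradient (p k) (zeta k).
    rewrite /penalty_step addrAC {1}/zeta /gradient_step.
    by rewrite [phi k - _ - _]addrAC subrr add0r.
  apply: (le_trans (sqnB_le2 _ _)); rewrite sqnN !sqnZ.
  have := gradient_lipschitz (p_diff2 k) (p_hess k) (zeta k) wstar (lexx 0) Lp_gt0.
  rewrite p_grad0 subr0 => h3.
  have h4 : sqn (zeta k - wstar) <=
      2 * sqn (phi k - wstar) + 2 * (mu ^+ 2 * sqn (gradient (J k) (phi k))).
    by rewrite /zeta /gradient_step addrAC -sqnZ sqnB_le2.
  have h5 : (mu * eta) ^+ 2 * sqn (gradient (p k) (zeta k)) <=
      (mu * eta) ^+ 2 * (Lp ^+ 2 * (2 * sqn (phi k - wstar)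
        + 2 * (mu ^+ 2 * sqn (gradient (J k) (phi k))))).
    rewrite ler_wpM2l ?sqr_ge0//; apply: (le_trans h3).
    by rewrite ler_wpM2l ?sqr_ge0.
  by lra.
rewrite /disagreement -(subrKA T).
apply: (le_trans (energyD_le2 _ _)); rewrite energyBC.
by lra.
Qed.

End ApproximateFixedPoint.

End NoiseFree.

(** * Compactness and continuity for families of agent vectors in the product topology *)

Section StackTopology.
Context {R : realType} {M N : nat}.
Implicit Types (x : 'I_N -> 'rV[R]_M) (B : 'M[R]_N) (w : 'rV[R]_M).

Local Notation stack := (prod_topology (fun _ : 'I_N => 'rV[R]_M)).

Lemma agent_continuous k : continuous (fun x : stack => x k).
Proof. exact: (@proj_continuous _ (fun _ : 'I_N => 'rV[R]_M) k). Qed.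

Lemma mix_continuous (T : topologicalType) (F : T -> 'I_N -> 'rV[R]_M) B k :
  (forall l, continuous (fun t => F t l)) -> continuous (fun t => mix B (F t) k).
Proof.
move=> cF; apply: continuous_big => [|l _]; first exact: add_continuous.
move=> t; apply: (@continuous_comp _ _ _ (fun t => F t l)); first exact: cF.
exact: scaler_continuous.
Qed.

Lemma energy_continuous (T : topologicalType) (F : T -> 'I_N -> 'rV[R]_M) :
  (forall k, continuous (fun t => F t k)) -> continuous (fun t => energy (F t)).
Proof. by move=> cF; apply: sum_continuous => k; exact: dot_continuous. Qed.

Lemma subr_continuous (T : topologicalType) (F G : T -> 'rV[R]_M) :
  continuous F -> continuous G -> continuous (fun t => F t - G t).
Proof. by move=> cF cG t; apply: continuousB; [exact: cF|exact: cG]. Qed.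

Lemma energy_ball_compact w (r : R) :
  compact [set x : stack | energy (x - cst w) <= r].
Proof.
(* The half-side r + 1 avoids a square root: t^2 <= r gives |t| <= r + 1. *)
pose box := [set z : 'rV[R]_M | forall j, `[w 0 j - (r + 1), w 0 j + (r + 1)]%classic (z 0 j)].
have cbox : compact box.
  apply: (@rV_compact _ _ (fun j => `[w 0 j - (r + 1), w 0 j + (r + 1)]%classic)).
  by move=> j; exact: segment_compact.
have cE : continuous (fun x : stack => energy (x - cst w)).
  apply: (@energy_continuous _ (fun x : stack => (x : 'I_N -> 'rV[R]_M) - cst w)) => k.
  by apply: subr_continuous; [exact: agent_continuous|exact: cst_continuous].
apply: (@subclosed_compact _ _ [set x : stack | forall k, box (x k)]).
- by apply: (closed_comp _ (@closed_le _ r)) => x _; exact: cE.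
- exact: (@tychonoff _ (fun _ : 'I_N => 'rV[R]_M) (fun=> box)).
- move=> x /= xr k j /=; rewrite in_itv /=.
  have h : (x k 0 j - w 0 j) ^+ 2 <= r.
    apply: le_trans xr; apply: le_trans (sqn_le_energy _ k).
    rewrite sqnE (bigD1 j)//= !mxE lerDl sumr_ge0// => i _; exact: sqr_ge0.
  have r0 : 0 <= r by apply: le_trans h; exact: sqr_ge0.
  have : `|x k 0 j - w 0 j| <= r + 1.
    rewrite -ler_sqr ?nnegrE ?addr_ge0// real_normK ?num_real//; apply: (le_trans h).
    by have := mulr_ge0 r0 r0; rewrite expr2; lra.
  by rewrite ler_norml => /andP[? ?]; apply/andP; split; lra.
Qed.

End StackTopology.

(** * Characterization of [wstar] and its quantitative form by compactness *)

Section StationaryPoints.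
Context {R : realType} {M N : nat}.
Variables (A1 A2 : 'M[R]_N) (J p : 'I_N -> 'rV[R]_M -> R).
Variables (lam L : R) (wstar : 'rV[R]_M).
Hypothesis A1_col : forall k, \sum_l A1 l k = 1.
Hypothesis consensus : forall x : 'I_N -> 'rV[R]_M,
  mix A2 (mix A1 x) = x -> forall k l, x k = x l.
Hypothesis lam_gt0 : 0 < lam.
Hypothesis J_diff2 : forall k, twice_differentiable (J k).
Hypothesis J_hess : forall k w, loewner_le lam%:M (hessian (J k) w) /\
  loewner_le (hessian (J k) w) L%:M.
Hypothesis p_continuous : forall k, continuous (p k).
Hypothesis p_ge0 : forall k z, 0 <= p k z.
Hypothesis wstar_opt : forall z, (forall k, p k z = 0) ->
  \sum_k J k wstar <= \sum_k J k z.

Local Notation stack := (prod_topology (fun _ : 'I_N => 'rV[R]_M)).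

Lemma stationary_eq_minimizer (x : 'I_N -> 'rV[R]_M) :
  disagreement A1 A2 x <= 0 -> violation A1 p x <= 0 ->
  slope A1 J wstar x <= 0 -> x = cst wstar.
Proof.
move=> dx vx sx; have xfix : x = mix A2 (mix A1 x).
  apply/funext => k; apply/eqP; rewrite -subr_eq0; apply/eqP/sqn_eq0/eqP.
  rewrite eq_le sqn_ge0 andbT; apply: le_trans dx.
  exact: (sqn_le_energy (x - mix A2 (mix A1 x)) k).
have xcons := consensus (esym xfix).
(* The agent [k0] supplies the common value [z] and, below, makes the strict inequality between sums
   legitimate, since the sums are not empty. *)
apply/funext => k0; pose z := x k0.
have xz : x = cst z by apply/funext => k; exact: xcons.
have phiz : mix A1 x = cst z by rewrite xz mix_cst.
have pz k : p k z = 0.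
  apply/eqP; rewrite eq_le p_ge0 andbT; apply: le_trans vx.
  rewrite /violation phiz (bigD1 k)//= lerDl.
  by apply: sumr_ge0.
have [->//|zw] := eqVneq (x k0) wstar; exfalso; rewrite -/z in zw.
have : slope A1 J wstar x > \sum_k J k z - \sum_k J k wstar.
  rewrite /slope phiz -sumrB; apply: ltr_sum.
    by apply/hasP; exists k0 => //; exact: mem_index_enum.
  by move=> k _; exact: (strictly_convex_gradient_ineq (J_diff2 k) (J_hess k)).
by have := wstar_opt pz; lra.
Qed.

(** On the compact shell of points within B but at least eps away, the maximum of the three
    quantities is continuous and, by the previous lemma, positive. Half of its minimum serves as
    kappa; if the shell is empty, any kappa does. *)
Lemma almost_stationary_close (B eps : R) : 0 < eps ->
  exists2 kappa, 0 < kappa & forall x : 'I_N -> 'rV[R]_M,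
    energy (x - cst wstar) <= B ->
    disagreement A1 A2 x <= kappa -> violation A1 p x <= kappa ->
    slope A1 J wstar x <= kappa -> energy (x - cst wstar) <= eps.
Proof.
move=> eps0.
pose E (x : stack) := energy (x - cst wstar).
pose K := [set x : stack | E x <= B] `&` [set x | eps <= E x].
have [[x0 Kx0]|K0] := pselect (K !=set0); last first.
  exists 1 => // x xB _ _ _; rewrite leNgt; apply/negP => xe.
  by apply: K0; exists x; split => //; exact: ltW.
have cphi k : continuous (fun x : stack => mix A1 x k).
  by apply: mix_continuous => l; exact: agent_continuous.
have cE : continuous E.
  apply: (@energy_continuous _ _ _ _ (fun x : stack => (x : 'I_N -> 'rV[R]_M) - cst wstar)) => k.
  by apply: subr_continuous; [exact: agent_continuous|exact: cst_continuous].
have cK : compact K.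
  apply: (@subclosed_compact _ _ [set x : stack | E x <= B]).
  - apply: closedI.
      by apply: (closed_comp _ (@closed_le _ B)) => x _; exact: cE.
    by apply: (closed_comp _ (@closed_ge _ eps)) => x _; exact: cE.
  - exact: energy_ball_compact.
  - by move=> x [].
pose F (x : stack) := Num.max (Num.max (disagreement A1 A2 x) (violation A1 p x))
                              (slope A1 J wstar x).
have cF : continuous F.
  apply: max_fun_continuous; first apply: max_fun_continuous.
  - apply: (@energy_continuous _ _ _ _
      (fun x : stack => (x : 'I_N -> 'rV[R]_M) - mix A2 (mix A1 x))) => k.
    by apply: subr_continuous; [exact: agent_continuous|exact: mix_continuous].
  - apply: sum_continuous => k x.
    apply: (@continuous_comp _ _ _ (fun x : stack => mix A1 x k)); first exact: cphi.
    exact: p_continuous.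
  - apply: sum_continuous => k; apply: dot_continuous; last first.
      by apply: subr_continuous; [exact: cphi|exact: cst_continuous].
    move=> x; apply: (@continuous_comp _ _ _ (fun x : stack => mix A1 x k)).
      exact: cphi.
    exact: gradient_continuous.
have [c /set_mem [cB ce] cmin] :=
  compact_EVT_min (ex_intro _ x0 Kx0) cK (continuous_subspaceT cF).
have Fc : 0 < F c.
  rewrite ltNge; apply/negP; rewrite /F !ge_max => /andP[/andP[h1 h2] h3].
  have cw := stationary_eq_minimizer h1 h2 h3.
  move: ce => /=; rewrite /E cw subrr /energy big1 ?leNgt ?eps0//.
  by move=> k _; exact: sqn0.
exists (F c / 2); first by rewrite divr_gt0.
move=> x xB h1 h2 h3; rewrite leNgt; apply/negP => xe.
have : F c <= F x by apply: cmin; apply/mem_set; split => //; exact: ltW.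
apply/negP; rewrite -ltNge (@le_lt_trans _ _ (F c / 2))//.
  by rewrite /F !ge_max h1 h2 h3.
by rewrite ltr_pdivrMr// ltr_pMr// ltr1n.
Qed.

End StationaryPoints.

(** * Geometric decay and affine recursions *)

Section GeometricRecursion.
Context {R : realType}.
Implicit Types (q a c e : R) (V : nat -> R).

Lemma geometric_eventually_le q a e : 0 <= q < 1 -> 0 < e ->
  exists i0, forall i, (i0 <= i)%N -> q ^+ i * a <= e.
Proof.
move=> /andP[q0 q1] e0.
have /cvgrPdist_le/(_ _ e0) : geometric a q n @[n --> \oo] --> (0 : R).
  by apply: cvg_geometric; rewrite ger0_norm.
case=> i0 _ h; exists i0 => i /h /=; rewrite sub0r normrN mulrC.
by apply: le_trans; exact: ler_norm.
Qed.

Lemma affine_recursion_eventually_le q c e V : 0 <= q < 1 -> 0 < e ->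
  (forall i, V i.+1 <= q * V i + c) ->
  exists i0, forall i, (i0 <= i)%N -> V i <= c / (1 - q) + e.
Proof.
move=> q01 e0 Vrec; have /andP[q0 q1] := q01.
have [i0 h] := geometric_eventually_le (V 0 - c / (1 - q)) q01 e0.
exists i0 => i /h hi.
apply: (@le_trans _ _ (q ^+ i * (V 0 - c / (1 - q)) + c / (1 - q))); last by lra.
elim: i {hi} => [|i IH]; first by rewrite expr0 mul1r subrK.
apply: (le_trans (Vrec i)).
have -> : q ^+ i.+1 * (V 0 - c / (1 - q)) + c / (1 - q) =
   q * (q ^+ i * (V 0 - c / (1 - q)) + c / (1 - q)) + c.
  by rewrite exprS; field; rewrite subr_eq0 gt_eqF.
by rewrite lerD2r ler_wpM2l.
Qed.

End GeometricRecursion.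

(** * The noise-free run ends up close to [wstar] for small parameters *)

Section NoiseFreeLimit.
Context {R : realType} {M N : nat}.
Variables (A1 A2 : 'M[R]_N) (J p : 'I_N -> 'rV[R]_M -> R).
Variables (lam L Lp : R) (wstar : 'rV[R]_M).
Hypotheses (A1_ds : doubly_stochastic A1) (A2_ds : doubly_stochastic A2).
Hypothesis consensus : forall x : 'I_N -> 'rV[R]_M,
  mix A2 (mix A1 x) = x -> forall k l, x k = x l.
Hypotheses (lam_gt0 : 0 < lam) (L_gt0 : 0 < L) (Lp_gt0 : 0 < Lp).
Hypothesis J_diff2 : forall k, twice_differentiable (J k).
Hypothesis p_diff2 : forall k, twice_differentiable (p k).
Hypothesis J_hess : forall k w, loewner_le lam%:M (hessian (J k) w) /\
  loewner_le (hessian (J k) w) L%:M.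
Hypothesis p_hess : forall k w, loewner_le 0%:M (hessian (p k) w) /\
  loewner_le (hessian (p k) w) Lp%:M.
Hypothesis p_grad0 : forall k, gradient (p k) wstar = 0.
Hypothesis p_wstar : forall k, p k wstar = 0.
Hypothesis p_ge0 : forall k z, 0 <= p k z.
Hypothesis wstar_opt : forall z, (forall k, p k z = 0) ->
  \sum_k J k wstar <= \sum_k J k z.

(** In this and the next two statements [l] stands for Lp^2, [s] for mu * eta and [t] for 1 / eta.
    The common factor is deliberately crude: it dominates the coefficients of all three bounds, so
    one smallness condition serves them all. *)
Let disagreement_arith (mu s B G l kappa : R) :
  0 <= mu -> mu <= 1 -> 0 <= s -> s <= 1 -> 0 <= B -> 0 <= G -> 0 <= l ->
  mu * (10 * B + 10 + 10 * G + 16 * (l * B) + 16 * (l * G)) <= kappa ->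
  s * (10 * B + 10 + 10 * G + 16 * (l * B) + 16 * (l * G)) <= kappa ->
  2 * mu ^+ 4 + 4 * mu ^+ 2 * G + 4 * s ^+ 2 * l * (2 * B + 2 * mu ^+ 2 * G)
    <= kappa.
Proof.
move=> mu0 mu1 s0 s1 B0 G0 l0 hmu hs.
have sq (t : R) : 0 <= t -> t <= 1 -> t ^+ 2 <= t.
  by move=> t0 t1; rewrite expr2 ler_piMl.
have mu2 := sq _ mu0 mu1; have s2 := sq _ s0 s1.
have mu20 := sqr_ge0 mu; have s20 := sqr_ge0 s.
have h1 : mu ^+ 4 <= mu.
  rewrite -[4%N]/(2 * 2)%N exprM; apply: (le_trans _ mu2).
  by apply: sq => //; exact: le_trans mu2 mu1.
have h2 : mu ^+ 2 * G <= mu * G by rewrite ler_wpM2r.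
have lB := mulr_ge0 l0 B0; have lG := mulr_ge0 l0 G0.
have h3 : s ^+ 2 * (l * B) <= s * (l * B) by rewrite ler_wpM2r.
have h4 : s ^+ 2 * mu ^+ 2 * (l * G) <= s * (l * G).
  by rewrite ler_wpM2r// -[leRHS]mulr1 ler_pM//; exact: le_trans mu2 mu1.
have := mulr_ge0 mu0 B0; have := mulr_ge0 mu0 G0; have := mulr_ge0 s0 B0.
have := mulr_ge0 s0 G0; have := mulr_ge0 mu0 lB; have := mulr_ge0 mu0 lG.
have := mulr_ge0 s0 lB; have := mulr_ge0 s0 lG.
by move=> *; lra.
Qed.

Let violation_arith (mu t B G l kappa : R) :
  0 <= mu -> 0 <= t -> 0 <= B -> 0 <= G -> 0 <= l ->
  mu * (10 * B + 10 + 10 * G + 16 * (l * B) + 16 * (l * G)) <= kappa ->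
  t * (10 * B + 10 + 10 * G + 16 * (l * B) + 16 * (l * G)) <= kappa ->
  t * (3 * B + 4 + 2 * G) + mu * (l * B + G) <= kappa.
Proof.
move=> mu0 t0 B0 G0 l0 hmu ht.
have lB := mulr_ge0 l0 B0; have lG := mulr_ge0 l0 G0.
have := mulr_ge0 mu0 B0; have := mulr_ge0 mu0 G0; have := mulr_ge0 t0 B0.
have := mulr_ge0 t0 G0; have := mulr_ge0 mu0 lB; have := mulr_ge0 mu0 lG.
have := mulr_ge0 t0 lB; have := mulr_ge0 t0 lG.
by move=> *; lra.
Qed.

Let slope_arith (mu z B G l kappa : R) :
  0 <= mu -> 0 <= kappa -> 0 <= B -> 0 <= G -> 0 <= l ->
  mu * (10 * B + 10 + 10 * G + 16 * (l * B) + 16 * (l * G)) <= kappa ->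
  2 * z <= mu * (2 * B + 4 + G) -> z <= kappa.
Proof.
move=> mu0 k0 B0 G0 l0 hmu hz.
have lB := mulr_ge0 l0 B0; have lG := mulr_ge0 l0 G0.
have := mulr_ge0 mu0 B0; have := mulr_ge0 mu0 G0.
have := mulr_ge0 mu0 lB; have := mulr_ge0 mu0 lG.
by move=> *; lra.
Qed.

Lemma noise_free_run_close (eps : R) : 0 < eps ->
  exists2 tau, 0 < tau & forall mu eta, 0 < mu -> mu <= tau -> 0 < eta ->
    mu * eta <= tau -> eta^-1 <= tau ->
    [/\ mu * L <= 1, mu * lam < 1, mu * eta * Lp <= 1 &
     exists i0, forall i, (i0 <= i)%N ->
       energy (noise_free_run A1 A2 J p wstar mu (mu * eta) i - cst wstar) <= eps].
Proof.
move=> eps0; have lam0 := lam_gt0; have L0 := L_gt0; have Lp0 := Lp_gt0.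
pose B := 2 * J_residual J wstar / lam ^+ 2.
have b0 := J_residual_ge0 J wstar.
have B0 : 0 <= B by apply: divr_ge0; [exact: mulr_ge0|exact: sqr_ge0].
have [kappa kappa0 close] := almost_stationary_close (let: And3 _ _ c := A1_ds in c)
  consensus lam_gt0 J_diff2 J_hess
  (fun k => twice_differentiable_continuous (p_diff2 k)) p_ge0 wstar_opt B eps0.
pose G := 2 * L ^+ 2 * B + 2 * J_residual J wstar.
have G0 : 0 <= G.
  by apply: addr_ge0; [apply: mulr_ge0 => //; apply: mulr_ge0 => //; exact: sqr_ge0
                      |exact: mulr_ge0].
have LpB0 : 0 <= Lp ^+ 2 * B by apply: mulr_ge0 => //; exact: sqr_ge0.
have LpG0 : 0 <= Lp ^+ 2 * G by apply: mulr_ge0 => //; exact: sqr_ge0.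
have [C C0 CE] : exists2 C, 0 < C &
    C = 10 * B + 10 + 10 * G + 16 * (Lp ^+ 2 * B) + 16 * (Lp ^+ 2 * G).
  by eexists; last reflexivity; lra.
have [ck ck0 ckE] : exists2 ck, 0 < ck & ck = C / kappa.
  by exists (C / kappa); rewrite ?divr_gt0.
(* One summand for each smallness condition: 1 for mu <= 1, L for positivity of I - mu H, 2 lam for
   the strict mu lam < 1, 2 Lp for the descent estimate of the penalty step, and C / kappa for the
   three bounds. The threshold is 1 / D. *)
pose D := 1 + L + 2 * lam + 2 * Lp + ck.
have D0 : 0 < D by rewrite /D !addr_gt0// mulr_gt0.
have Dinv (a t : R) : 0 <= a -> a <= D -> 0 <= t -> t <= D^-1 -> t * a <= 1.
  move=> a0 aD t0 tD; apply: (@le_trans _ _ (D^-1 * D)); first exact: ler_pM.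
  by rewrite mulVf// gt_eqF.
exists D^-1; first by rewrite invr_gt0.
move=> mu eta mu0 mutau eta0 stau etatau.
have mu0' := ltW mu0; set s := mu * eta in stau *.
have s0 : 0 <= s by rewrite mulr_ge0// ltW.
have muL : mu * L <= 1 by apply: Dinv => //; rewrite /D; lra.
have mulam : mu * lam < 1.
  have : mu * (2 * lam) <= 1 by apply: Dinv => //; rewrite /D; lra.
  by have := mulr_gt0 mu0 lam_gt0; lra.
have sLp2 : 2 * s * Lp <= 1.
  by rewrite [2 * s]mulrC -mulrA; apply: Dinv => //; rewrite /D; lra.
have sLp : s * Lp <= 1.
  by apply: le_trans sLp2; rewrite -mulrA mulr_natl mulr2n lerDl mulr_ge0// ltW.
have small t : 0 <= t -> t <= D^-1 -> t * C <= kappa /\ t <= 1.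
  move=> t0 tD; split.
    have : t * ck <= 1 by apply: Dinv => //; [exact: ltW|rewrite /D; lra].
    by rewrite ckE mulrA ler_pdivrMr// mul1r.
  by rewrite -[t]mulr1; apply: Dinv => //; rewrite /D; lra.
split => //.
have mulam01 : 0 <= 1 - mu * lam < 1.
  by rewrite subr_ge0 (ltW mulam)/= gtrBl mulr_gt0.
have mu40 : 0 < mu ^+ 4 by rewrite exprn_gt0.
have [i0 hi0] := geometric_eventually_le (mu ^+ 2 * J_residual J wstar) mulam01 mu40.
exists i0 => i /hi0 gap.
set x := noise_free_run _ _ _ _ _ _ _ _.
have xB : energy (x - cst wstar) <= B.
  exact: (noise_free_run_bounded A1_ds A2_ds lam_gt0 J_diff2 p_diff2 J_hess p_hess).
have xfix : energy (noise_free_step A1 A2 J p mu s x - x) <= mu ^+ 4.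
  apply: le_trans gap.
  exact: (noise_free_run_gap A1_ds A2_ds lam_gt0 J_diff2 p_diff2 J_hess p_hess).
have [muC mu1] := small _ mu0' mutau.
have [sC s1] := small _ s0 stau.
have etai0 : 0 <= eta^-1 by rewrite invr_ge0 ltW.
have [etaC _] := small _ etai0 etatau.
rewrite CE in muC sC etaC.
have Lp2 := sqr_ge0 Lp.
apply: close => //.
- apply: (le_trans (disagreement_le A1_ds A2_ds lam_gt0 L_gt0 Lp_gt0 J_diff2 p_diff2
    J_hess p_hess p_grad0 mu0 eta0 xB xfix)).
  exact: disagreement_arith.
- apply: (le_trans (violation_le A1_ds A2_ds lam_gt0 L_gt0 Lp_gt0 J_diff2 p_diff2
    J_hess p_hess p_grad0 p_wstar B0 mu0 eta0 mu1 sLp2 xB xfix)).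
  exact: violation_arith.
- apply: slope_arith muC _ => //; first exact: ltW.
  exact: (slope_le A1_ds A2_ds lam_gt0 L_gt0 J_diff2 p_diff2 J_hess p_hess
    p_grad0 p_wstar p_ge0 mu0 eta0 mu1 sLp2 xB xfix).
Qed.

End NoiseFreeLimit.

(** * Measurability of vector-valued maps through their coordinates *)

Section VectorMeasurability.
Context {R : realType} {M : nat}.

(** The measurable space is a parameter, so the same closure lemmas serve the ambient sigma-algebra
    and the histories. *)
Definition vector_measurable_fun {d} {T : measurableType d} (X : T -> 'rV[R]_M) :=
  forall j, measurable_fun setT (fun t => X t 0 j).

Section OneSpace.
Context {d} {T : measurableType d}.
Implicit Types (X Y : T -> 'rV[R]_M).

(* An open set is the union of the rational cubes that it contains. *)
Lemma open_preimage_vector_measurable X (O : set 'rV[R]_M) :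
  vector_measurable_fun X -> open O -> measurable (X @^-1` O).
Proof.
move=> mX oO.
pose center (q : 'rV[rat]_M) : 'rV[R]_M := map_mx ratr q.
pose cube (c : 'rV[rat]_M * nat) :=
  [set z : 'rV[R]_M | forall j, `|center c.1 0 j - z 0 j| < c.2.+1%:R^-1].
pose F (c : 'rV[rat]_M * nat) :=
  if `[< cube c `<=` O >] then X @^-1` cube c else set0.
have -> : X @^-1` O = \bigcup_c F c.
  apply/seteqP; split => [t Ot|t [c _]]; last first.
    by rewrite /F; case: asboolP => // cO; exact: cO.
  have /nbhs_ballP[e /= e0 eO] : nbhs (X t) O by exact: open_nbhs_nbhs.
  have [n ne] : exists n : nat, 2 * n.+1%:R^-1 <= e.
    have e20 : 0 < e / 2 by rewrite divr_gt0.
    have [n _ /(_ n (leqnn n)) /= h] := near_infty_natSinv_lt (PosNum e20).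
    have {}h : n.+1%:R^-1 < e / 2 := h.
    by exists n; rewrite mulrC -ler_pdivlMr// ltW.
  have n0 : 0 < n.+1%:R^-1 :> R by rewrite invr_gt0.
  have /choice[q qX] : forall j, exists q : rat,
      `|ratr q - X t 0 j| < n.+1%:R^-1.
    move=> j; have lt : X t 0 j - n.+1%:R^-1 < X t 0 j + n.+1%:R^-1.
      by rewrite ltrD2l gtrN.
    have [q] := rat_in_itvoo lt; rewrite in_itv /= => /andP[? ?]; exists q.
    by rewrite ltr_norml; apply/andP; split; [rewrite ltrBrDl|rewrite ltrBlDl].
  exists (\row_j q j, n) => //; rewrite /F; case: asboolP => [_|].
    by move=> j /=; rewrite !mxE; exact: qX.
  case => z /= hz; apply: eO; split=> // i j; rewrite ord1 /ball /=.
  have := hz j; have := qX j; rewrite !mxE => h1 h2; apply: lt_le_trans ne.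
  rewrite mulr_natl mulr2n -(subrKA (ratr (q j))).
  by apply: (le_lt_trans (ler_normD _ _)); rewrite ltrD// distrC.
apply: countable_bigcupT_measurable; first exact: countableP.
move=> [q n]; rewrite /F; case: asboolP => // _.
have -> : X @^-1` cube (q, n) = \bigcap_(j in [set: 'I_M])
    (fun t => X t 0 j) @^-1` ball (center q 0 j) n.+1%:R^-1.
  by apply/seteqP; split => t h j; [move=> _; exact: h|exact: (h j I)].
apply: fin_bigcap_measurable; first exact: finite_finset.
move=> j _; rewrite -[X in measurable X]setTI; apply: mX => //.
exact: measurable_ball.
Qed.

Lemma continuous_comp_measurable X (f : 'rV[R]_M -> R) :
  vector_measurable_fun X -> continuous f -> measurable_fun setT (f \o X).
Proof.
move=> mX cf; apply: (measurability _ (RGenOpens.measurableE R)).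
move=> _ [_ [a [b ->] <-]]; rewrite setTI comp_preimage.
apply: open_preimage_vector_measurable => //.
apply: open_comp => [x _|]; [exact: cf|exact: interval_open].
Qed.

Lemma vector_measurable_comp X (F : 'rV[R]_M -> 'rV[R]_M) :
  vector_measurable_fun X -> continuous F -> vector_measurable_fun (F \o X).
Proof.
move=> mX cF j; apply: (continuous_comp_measurable (f := fun x => F x 0 j)) => //.
move=> x; apply: (@continuous_comp _ _ _ F (fun v : 'rV[R]_M => v 0 j)).
  exact: cF.
exact: coord_continuous.
Qed.

Lemma vector_measurable_cst c : vector_measurable_fun (fun _ : T => c).
Proof. by move=> j; exact: measurable_cst. Qed.

Lemma vector_measurableB X Y : vector_measurable_fun X -> vector_measurable_fun Y ->
  vector_measurable_fun (fun t => X t - Y t).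
Proof.
move=> mX mY j; under eq_fun do rewrite !mxE.
by apply: measurable_funB; [exact: mX|exact: mY].
Qed.

Lemma vector_measurableZ c X : vector_measurable_fun X ->
  vector_measurable_fun (fun t => c *: X t).
Proof.
move=> mX j; under eq_fun do rewrite !mxE.
by apply: measurable_funM; [exact: measurable_cst|exact: mX].
Qed.

Lemma vector_measurable_mix N (B : 'M[R]_N) (W : T -> 'I_N -> 'rV[R]_M) k :
  (forall l, vector_measurable_fun (fun t => W t l)) ->
  vector_measurable_fun (fun t => mix B (W t) k).
Proof.
move=> mW j; rewrite /mix; under eq_fun do rewrite summxE.
by apply: measurable_sum => l; exact: (vector_measurableZ (B l k) (mW l)).
Qed.

Lemma measurable_dot X Y : vector_measurable_fun X -> vector_measurable_fun Y ->
  measurable_fun setT (fun t => dot (X t) (Y t)).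
Proof.
move=> mX mY; apply: measurable_sum => j.
by apply: measurable_funM; [exact: mX|exact: mY].
Qed.

Lemma measurable_sqn X : vector_measurable_fun X ->
  measurable_fun setT (fun t => sqn (X t)).
Proof. by move=> mX; exact: measurable_dot. Qed.

End OneSpace.

Lemma vector_measurable_wrtP d (T : measurableType d) (G : set (set T))
    (X : T -> 'rV[R]_M) :
  vector_measurable_wrt <<s G>> X <->
  @vector_measurable_fun _ (g_sigma_algebraType G) X.
Proof.
split=> mX j; first by move=> _ B mB; rewrite setTI; exact: mX.
by move=> B mB; rewrite -[_ @^-1` _]setTI; exact: mX.
Qed.

End VectorMeasurability.

(** * Square-integrable random vectors *)

Section SquareIntegrable.
Context {d} {Omega : measurableType d} {R : realType} {M : nat}.
Variable P : probability Omega R.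
Implicit Types (f h : Omega -> R) (X Y : Omega -> 'rV[R]_M).

Local Notation integrable f := (P.-integrable setT (EFin \o f)).

Lemma integrable_dominated f h : measurable_fun setT f ->
  (forall t, `|f t| <= h t) -> integrable h -> integrable f.
Proof.
move=> mf fh ih; apply: le_integrable ih => //; first exact/measurable_EFinP.
by move=> t _ /=; rewrite lee_fin (le_trans (fh t))// ler_norm.
Qed.

Lemma integrable_fsum (I : finType) (F : I -> Omega -> R) :
  (forall i, integrable (F i)) -> integrable (fun t => \sum_i F i t).
Proof.
move=> iF; have -> : EFin \o (fun t => \sum_i F i t) =
    (fun t => \sum_(i <- index_enum I) (F i t)%:E)%E.
  by apply/funext => t /=; rewrite sumEFin.
apply: (@integrable_sum _ _ _ P setT measurableT _ _ xpredT (fun i t => (F i t)%:E)).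
by move=> i _; exact: iF.
Qed.

Lemma Rintegral_fsum (I : finType) (F : I -> Omega -> R) :
  (forall i, integrable (F i)) ->
  \int[P]_t (\sum_i F i t) = \sum_i \int[P]_t F i t.
Proof.
move=> iF; rewrite /Rintegral; under eq_integral do rewrite -sumEFin.
rewrite (@integral_sum _ _ _ P setT measurableT _ (fun i t => (F i t)%:E))//.
rewrite -[RHS]/(fine (_%:E)) -sumEFin; congr fine; apply: eq_bigr => i _.
by rewrite fineK//; exact: (integrable_fin_num measurableT (iF i)).
Qed.

Lemma integrableDr f h : integrable f -> integrable h ->
  integrable (fun t => f t + h t).
Proof. by move=> fi hi; exact: (integrableD measurableT fi hi). Qed.

Lemma integrableZr (c : R) f : integrable f -> integrable (fun t => c * f t).
Proof. by move=> fi; exact: (integrableZl measurableT c fi). Qed.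

Lemma integrable_const (c : R) : integrable (fun=> c).
Proof. exact: finite_measure_integrable_cst. Qed.

Definition square_integrable X :=
  vector_measurable_fun X /\ integrable (fun t => sqn (X t)).

Lemma square_integrable_dominated X h : vector_measurable_fun X ->
  (forall t, sqn (X t) <= h t) -> integrable h -> square_integrable X.
Proof.
move=> mX Xh ih; split => //.
apply: (integrable_dominated _ _ ih); first exact: measurable_sqn.
by move=> t; rewrite ger0_norm ?sqn_ge0.
Qed.

Lemma integrable_dot X Y : square_integrable X -> square_integrable Y ->
  integrable (fun t => dot (X t) (Y t)).
Proof.
move=> [mX iX] [mY iY]; apply: (integrable_dominated _ _ (integrableDr iX iY)).
  exact: measurable_dot.
move=> t; have := dot_young (X t) (Y t); have := normr_ge0 (dot (X t) (Y t)).
by lra.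
Qed.

Lemma square_integrable_integrable X j : square_integrable X ->
  integrable (fun t => X t 0 j).
Proof.
move=> [mX iX].
apply: (integrable_dominated _ _ (integrableDr (integrable_const 1) iX)).
  exact: mX.
move=> t; have : X t 0 j ^+ 2 <= sqn (X t).
  by rewrite sqnE (bigD1 j)//= lerDl sumr_ge0// => i _; exact: sqr_ge0.
have := sqr_ge0 (`|X t 0 j| - 1); rewrite -[X t 0 j ^+ 2]real_normK ?num_real//.
by have := normr_ge0 (X t 0 j); rewrite sqrrB1; lra.
Qed.

Lemma second_moment_Rintegral X : square_integrable X ->
  second_moment P X = (\int[P]_t sqn (X t))%:E.
Proof.
move=> [mX iX]; rewrite /second_moment unlock /Rintegral fineK; last first.
  exact: (integrable_fin_num measurableT iX).
by apply: eq_integral => t _; rewrite enorm_sqr.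
Qed.

Lemma second_moment_square_integrable X : random_vector X ->
  (second_moment P X < +oo)%E -> square_integrable X.
Proof.
move=> mX mom; have mX' : vector_measurable_fun X.
  by move=> j _ B mB; rewrite setTI; exact: mX.
split => //; apply/integrableP; split.
  by apply/measurable_EFinP; exact: measurable_sqn.
apply: le_lt_trans mom; rewrite /second_moment unlock.
rewrite le_eqVlt; apply/orP; left; apply/eqP.
by apply: eq_integral => t _; rewrite /= enorm_sqr ger0_norm// sqn_ge0.
Qed.

End SquareIntegrable.

(** * Orthogonality of a variable with zero conditional mean to the past *)

Section Orthogonality.
Import HBNNSimple.
Context {d} {Omega : measurableType d} {R : realType}.
Variables (P : probability Omega R) (G : set (set Omega)).
Hypothesis G_sub : <<s G>> `<=` measurable.
Implicit Types (V Y : Omega -> R).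

Local Notation integrable f := (P.-integrable setT (EFin \o f)).

Lemma measurable_wrt_measurable Y : measurable_wrt <<s G>> Y -> measurable_fun setT Y.
Proof. by move=> mY _ B mB; rewrite setTI; apply: G_sub; exact: mY. Qed.

(** A conditional expectation is tested on events only. Linearity extends this to simple functions,
    and dominated convergence, with |V Y| as dominating function, to nonnegative [Y]. *)
Let condexp0_orthogonal_ge0 V Y : is_condexp P <<s G>> V (fun=> 0) ->
  measurable_wrt <<s G>> Y -> (forall t, 0 <= Y t) ->
  integrable (fun t => V t * Y t) -> (\int[P]_t (V t * Y t)%:E = 0)%E.
Proof.
move=> [iV _ _ V0] mY Y0 iVY.
have mV : measurable_fun setT V.
  by apply/measurable_EFinP; exact: measurable_int iV.
have mEY : measurable_fun [set: g_sigma_algebraType G] (EFin \o Y).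
  by apply/measurable_EFinP => _ B mB; rewrite setTI; exact: mY.
(* The approximation is made over the sigma-algebra generated by [G], so that the level sets of the
   simple functions are admissible test events; [u] reads them back as functions on [Omega]. *)
have [g [gnd gY]] := approximation (@measurableT _ (g_sigma_algebraType G)) mEY
  (fun t _ => (Y0 t : (0 <= (Y t)%:E)%E)).
pose u n : Omega -> R := (g n : g_sigma_algebraType G -> R).
have g_le n t : u n t <= Y t.
  have g_homo : {homo (EFin \o g^~ t) : n m / (n <= m)%N >-> (n <= m)%E}.
    by move=> a b ab /=; rewrite lee_fin; have /lefP := gnd _ _ ab; exact.
  rewrite -lee_fin -[leRHS]/((EFin \o Y) t).
  rewrite (cvg_unique _ (gY t I) (ereal_nondecreasing_cvgn g_homo))//.
  by apply: ereal_sup_ubound; exists n.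
have mg n (r : R) : <<s G>> (u n @^-1` [set r]).
  exact: (@measurable_funPTI _ _ (g_sigma_algebraType G) _ (g n) [set r]).
have mgn n : measurable_fun setT (u n).
  move=> _ B mB; rewrite setTI; apply: G_sub.
  exact: (@measurable_funPTI _ _ (g_sigma_algebraType G) _ (g n) B).
have int_g n : (\int[P]_t (V t * u n t)%:E = 0)%E.
  pose s : seq R := finmap.enum_fset (fset_set (range (g n))).
  pose E (i : 'I_(size s)) : set Omega := u n @^-1` [set s`_i].
  have mE i : measurable (E i) by apply: G_sub; exact: mg.
  have iVE i : integrable (fun t => V t * \1_(E i) t).
    apply: (integrable_dominated _ _ (integrable_abse iV)) => [|t].
      by apply: measurable_funM => //; exact: measurable_indic.
    rewrite normrM ler_piMr// indicE; by case: (_ \in _); rewrite ?normr1 ?normr0.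
  have -> : (fun t => (V t * u n t)%:E) =
      (fun t => \sum_(i : 'I_(size s)) (s`_i * (V t * \1_(E i) t))%:E)%E.
    apply/funext => t; rewrite sumEFin /u (fimfunEord (g n)) mulr_sumr.
    by congr EFin; apply: eq_bigr => i _; rewrite mulrCA.
  rewrite (@integral_sum _ _ _ P setT measurableT _
    (fun (i : 'I_(size s)) t => (s`_i * (V t * \1_(E i) t))%:E)); last first.
    by move=> i; exact: (integrableZr _ (iVE i)).
  rewrite big1// => i _.
  under eq_integral do rewrite EFinM.
  rewrite integralZl//; last exact: iVE.
  suff -> : (\int[P]_t (V t * \1_(E i) t)%:E = 0)%E by rewrite mule0.
  transitivity (\int[P]_(t in E i) (V t)%:E)%E; last first.
    by rewrite V0 ?integral0//; exact: mg.
  rewrite [RHS]integral_mkcond; apply: eq_integral => t _.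
  by rewrite patchE indicE; case: (_ \in _); rewrite ?mulr1 ?mulr0.
have := @dominated_cvg _ _ _ P setT measurableT
  (fun n t => (V t * u n t)%:E) (fun t => (V t * Y t)%:E) (fun t => `|(V t * Y t)%:E|%E).
have -> : (fun n => \int[P]_t (V t * u n t)%:E)%E = (fun=> 0%E).
  by apply/funext => n; rewrite int_g.
move=> h; apply/esym; apply: (cvg_unique _ (cvg_cst _) (h _ _ _ _ _)) => //.
- move=> n; apply/measurable_EFinP; exact: measurable_funM.
- move=> t _; rewrite EFinM; under eq_fun do rewrite EFinM.
  by apply: cvgeZl => //; exact: gY.
- exact: integrable_abse.
- move=> n t _; rewrite lee_fin !normrM ler_wpM2l// [leRHS]ger0_norm//.
  by rewrite ger0_norm ?g_le//; exact: fun_ge0.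
Qed.

(** Positive and negative parts of [Y] are treated separately; integrability of V Y passes to both
    by domination. *)
Lemma condexp0_orthogonal V Y : is_condexp P <<s G>> V (fun=> 0) ->
  measurable_wrt <<s G>> Y -> integrable (fun t => V t * Y t) ->
  \int[P]_t (V t * Y t) = 0.
Proof.
move=> cV mY iVY; have mY' := measurable_wrt_measurable mY.
have iV : integrable V by case: cV.
have mV : measurable_fun setT V by apply/measurable_EFinP; exact: measurable_int iV.
pose Yp t := Num.max (Y t) 0; pose Yn t := Num.max (- Y t) 0.
have split_wrt (F : R -> R) : measurable_fun setT F -> measurable_wrt <<s G>> (F \o Y).
  move=> mF B mB; have mFB : measurable (F @^-1` B).
    by rewrite -[X in measurable X]setTI; exact: mF.
  exact: (mY _ mFB).
have mYp : measurable_wrt <<s G>> Yp.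
  by apply: (split_wrt (fun y => Num.max y 0)); exact: (@measurable_maxr _ _ _ setT id (cst 0)).
have mYn : measurable_wrt <<s G>> Yn.
  apply: (split_wrt (fun y => Num.max (- y) 0)).
  have m : measurable_fun setT ((fun y : R => - y) \max cst 0).
    by apply: measurable_maxr; [exact: oppr_measurable|exact: measurable_cst].
  exact: m.
have iVYp : integrable (fun t => V t * Yp t).
  apply: (integrable_dominated _ _ (integrable_abse iVY)) => [|t].
    by apply: measurable_funM => //; exact: measurable_wrt_measurable.
  rewrite !normrM ler_wpM2l// /Yp; case: (leP (Y t) 0) => _; by rewrite ?normr0.
have iVYn : integrable (fun t => V t * Yn t).
  apply: (integrable_dominated _ _ (integrable_abse iVY)) => [|t].
    by apply: measurable_funM => //; exact: measurable_wrt_measurable.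
  rewrite !normrM ler_wpM2l// /Yn; case: (leP (- Y t) 0) => _; by rewrite ?normr0 ?normrN.
have -> : (fun t => V t * Y t) = (fun t => V t * Yp t - V t * Yn t).
  apply/funext => t; rewrite -mulrBr /Yp /Yn; congr (_ * _).
  by case: (leP (Y t) 0); case: (leP (- Y t) 0); lra.
rewrite RintegralB// /Rintegral !condexp0_orthogonal_ge0 ?subrr//.
  by move=> t; rewrite /Yn le_max lexx orbT.
by move=> t; rewrite /Yp le_max lexx orbT.
Qed.

End Orthogonality.

(** * Mean-square distance between the noisy and the noise-free run *)

Section MeanSquare.
Context {d} {Omega : measurableType d} {R : realType} {M N : nat}.
Variables (P : probability Omega R) (A1 A2 : 'M[R]_N).
Variables (J p : 'I_N -> 'rV[R]_M -> R) (lam L Lp : R) (wstar : 'rV[R]_M).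
Hypotheses (A1_ds : doubly_stochastic A1) (A2_ds : doubly_stochastic A2).
Hypotheses (lam_gt0 : 0 < lam) (L_gt0 : 0 < L) (Lp_gt0 : 0 < Lp).
Hypothesis J_diff2 : forall k, twice_differentiable (J k).
Hypothesis p_diff2 : forall k, twice_differentiable (p k).
Hypothesis J_hess : forall k w, loewner_le lam%:M (hessian (J k) w) /\
  loewner_le (hessian (J k) w) L%:M.
Hypothesis p_hess : forall k w, loewner_le 0%:M (hessian (p k) w) /\
  loewner_le (hessian (p k) w) Lp%:M.
Variables (mu s : R) (alpha sigma_v2 : R).
Hypotheses (mu_gt0 : 0 < mu) (s_ge0 : 0 <= s) (alpha_ge0 : 0 <= alpha).
Hypotheses (muL_le1 : mu * L <= 1) (mulam_lt1 : mu * lam < 1) (sLp_le1 : s * Lp <= 1).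
Variables (w : nat -> 'I_N -> Omega -> 'rV[R]_M).
Variables (v : nat -> 'I_N -> Omega -> 'rV[R]_M -> 'rV[R]_M).
Hypothesis w_init : forall k, square_integrable P (w 0 k).
Hypothesis noise : gradient_noise_model P w v alpha sigma_v2.
Hypothesis w_step : forall i omega,
  (fun k => w i.+1 k omega) =
  noisy_step A1 A2 J p mu s
    (fun k => v i.+1 k omega (mix A1 (fun l => w i l omega) k))
    (fun l => w i l omega).

Local Notation integrable f := (P.-integrable setT (EFin \o f)).

Let phi i k omega := mix A1 (fun l => w i l omega) k.
Let n i k omega := v i.+1 k omega (phi i k omega).
Let x i := noise_free_run A1 A2 J p wstar mu s i.
(** The part of the error after the gradient stage that is free of the current noise. It is a
    function of the history, hence orthogonal to that noise. *)
Let q i k omega := gradient_step J mu k (phi i k omega) -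
  gradient_step J mu k (mix A1 (x i) k).
Let dev i omega : 'I_N -> 'rV[R]_M := (fun l => w i l omega) - x i.

(** The generators of [history w i], named so that the history can be used as a measurable space. *)
Let gen i := [set E | exists j (k : 'I_N) c, (j <= i)%N /\
  preimage_set_system setT (fun omega => w j k omega 0 c) (@measurable _ R) E].

Let step_continuous (f : 'rV[R]_M -> R) (c : R) : twice_differentiable f ->
  continuous (fun z : 'rV[R]_M => z - c *: gradient f z).
Proof.
move=> f2; have c1 : continuous (fun z : 'rV[R]_M => z) by move=> z; exact: cvg_id.
have c2 : continuous (fun z : 'rV[R]_M => c *: gradient f z).
  move=> z; apply: (@continuous_comp _ _ _ (gradient f)).
    exact: gradient_continuous.
  exact: scaler_continuous.
exact: subr_continuous c1 c2.
Qed.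

Let phi_history i k : vector_measurable_wrt (history w i) (phi i k).
Proof.
apply/vector_measurable_wrtP.
apply: (@vector_measurable_mix _ _ _ (g_sigma_algebraType (gen i)) _ A1
  (fun omega l => w i l omega)) => l j _ B mB.
rewrite setTI; apply: sub_gen_smallest; exists i, l, j; split => //.
by exists B => //; rewrite setTI.
Qed.

(** The model provides no joint measurability of the noise field; it makes the noise at [phi] a
    random vector because [phi] is measurable with respect to the history. The induction relies on
    this. *)
Let w_measurable i k : vector_measurable_fun (w i k).
Proof.
elim: i k => [|i IH] k; first by have [] := w_init k.
have mphi l : vector_measurable_fun (phi i l) by apply: vector_measurable_mix.
have mn l : vector_measurable_fun (n i l).
  have [mv _ _] := @noise i l _ (@phi_history i l).
  by move=> j _ B mB; rewrite setTI; exact: mv.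
have -> : w i.+1 k = (fun omega => mix A2 (fun l => penalty_step p s l
    (gradient_step J mu l (phi i l omega) - mu *: n i l omega)) k).
  by apply/funext => omega; exact: (congr1 (@^~ k) (w_step i omega)).
apply: vector_measurable_mix => l.
apply: (@vector_measurable_comp _ _ _ _
  (fun omega => gradient_step J mu l (phi i l omega) - mu *: n i l omega)
  (penalty_step p s l)); last exact: step_continuous.
apply: vector_measurableB; last exact: vector_measurableZ.
by apply: (@vector_measurable_comp _ _ _ _ (phi i l)) => //; exact: step_continuous.
Qed.

Let history_measurable i : history w i `<=` measurable.
Proof.
apply: smallest_sub; first exact: sigma_algebra_measurable.
move=> _ [j [k [c [_ [B mB <-]]]]].
exact: w_measurable.
Qed.

(** After expansion the cross term integrates to zero. The noise model involves E|phi|^2 and not a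
    distance, so [phi] is split along the noise-free run, whose energy about the origin is at most
    [c]; this produces both terms with 2 alpha. *)
Lemma mean_square_step i c :
  energy (x i) <= c ->
  integrable (fun omega => energy (dev i omega)) ->
  integrable (fun omega => energy (dev i.+1 omega)) /\
  \int[P]_omega energy (dev i.+1 omega) <=
    ((1 - mu * lam) ^+ 2 + 2 * alpha * mu ^+ 2) * \int[P]_omega energy (dev i omega)
    + mu ^+ 2 * (2 * alpha * c + N%:R * sigma_v2).
Proof.
move=> xc idev.
have mphi l : vector_measurable_fun (phi i l) by exact: vector_measurable_mix.
have mq l : vector_measurable_fun (q i l).
  apply: vector_measurableB; last exact: vector_measurable_cst.
  by apply: (@vector_measurable_comp _ _ _ _ (phi i l)) => //; exact: step_continuous.
have mdev j : measurable_fun setT (fun omega => energy (dev j omega)).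
  apply: measurable_sum => k; apply: measurable_sqn.
  by apply: vector_measurableB; [exact: w_measurable|exact: vector_measurable_cst].
have q_le omega : \sum_k sqn (q i k omega) <= (1 - mu * lam) ^+ 2 * energy (dev i omega).
  exact: (gradient_step_energy A1_ds J_diff2 J_hess (fun l => w i l omega) (x i)
    (ltW mu_gt0) muL_le1 mulam_lt1).
have phi_le omega : \sum_k sqn (phi i k omega) <= 2 * energy (dev i omega) + 2 * c.
  apply: (le_trans (energy_mix_le (fun l => w i l omega) A1_ds)).
  rewrite -(subrK (x i) (fun l => w i l omega)); apply: (le_trans (energyD_le2 _ _)).
  by rewrite lerD2l ler_wpM2l.
have sphi l : square_integrable P (phi i l).
  apply: (@square_integrable_dominated _ _ _ _ P _
     (fun omega => 2 * energy (dev i omega) + 2 * c)) => //.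
    move=> omega; apply: le_trans (phi_le omega).
    exact: (sqn_le_energy (fun k => phi i k omega) l).
  by apply: integrableDr; [exact: integrableZr|exact: integrable_const].
have sq l : square_integrable P (q i l).
  apply: (@square_integrable_dominated _ _ _ _ P _
     (fun omega => (1 - mu * lam) ^+ 2 * energy (dev i omega))) => //.
    move=> omega; apply: le_trans (q_le omega).
    exact: (sqn_le_energy (fun k => q i k omega) l).
  exact: integrableZr.
have n_mom l : (second_moment P (n i l) <=
    alpha%:E * (\int[P]_omega sqn (phi i l omega))%:E + sigma_v2%:E)%E.
  have [_ _] := @noise i l _ (@phi_history i l).
  by rewrite -[second_moment P (phi i l)]/(second_moment P (phi i l))
    (second_moment_Rintegral (sphi l)).
have sn l : square_integrable P (n i l).
  have [mv _ _] := @noise i l _ (@phi_history i l).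
  apply: second_moment_square_integrable => //.
  by apply: le_lt_trans (n_mom l) _; rewrite -EFinM -EFinD ltry.
have n_le l : \int[P]_omega sqn (n i l omega) <=
    alpha * \int[P]_omega sqn (phi i l omega) + sigma_v2.
  by have := n_mom l; rewrite (second_moment_Rintegral (sn l)) -EFinM -EFinD lee_fin.
have ortho l : \int[P]_omega dot (n i l omega) (q i l omega) = 0.
  have hq : vector_measurable_wrt (history w i) (q i l).
    apply/vector_measurable_wrtP; have /vector_measurable_wrtP hphi := @phi_history i l.
    apply: vector_measurableB; last exact: vector_measurable_cst.
    apply: (@vector_measurable_comp _ _ _ (g_sigma_algebraType (gen i)) (phi i l)) => //.
    exact: step_continuous.
  have [_ cv _] := @noise i l _ (@phi_history i l).
  (* The proviso under which the model grants zero conditional mean: it follows from the finite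
     second moment of [phi]. *)
  have inV : integrable_vector P (n i l).
    by move=> j; exact: square_integrable_integrable.
  have inq j : integrable (fun omega => n i l omega 0 j * q i l omega 0 j).
    apply: (integrable_dominated _ _ (integrableDr (sn l).2 (sq l).2)).
      by apply: measurable_funM; [exact: (sn l).1|exact: (sq l).1].
    move=> omega; set a := n i l omega 0 j; set b := q i l omega 0 j.
    have ha : a ^+ 2 <= sqn (n i l omega).
      by rewrite sqnE (bigD1 j)//= lerDl sumr_ge0// => k _; exact: sqr_ge0.
    have hb : b ^+ 2 <= sqn (q i l omega).
      by rewrite sqnE (bigD1 j)//= lerDl sumr_ge0// => k _; exact: sqr_ge0.
    have := sqr_ge0 (`|a| - `|b|); rewrite sqrrB !real_normK ?num_real// normrM.
    have := mulr_ge0 (normr_ge0 a) (normr_ge0 b); rewrite mulr2n.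
    by lra.
  rewrite Rintegral_fsum// big1// => j _.
  have cvj : is_condexp P (history w i) (fun omega => n i l omega 0 j) (fun=> 0).
    have -> : (fun _ : Omega => 0 : R) = (fun _ : Omega => (0 : 'rV[R]_M) 0 j).
      by apply/funext => omega; rewrite mxE.
    exact: cv.
  exact: (condexp0_orthogonal (@history_measurable i) cvj (hq j) (inq j)).
have idot l : integrable (fun omega => dot (n i l omega) (q i l omega)).
  exact: integrable_dot.
(* The expanded square of q - mu n, with the contraction of [q] inserted. The cross term is kept,
   since it vanishes only after integration. *)
pose bound omega := (1 - mu * lam) ^+ 2 * energy (dev i omega) +
  \sum_l (- (2 * mu) * dot (n i l omega) (q i l omega) + mu ^+ 2 * sqn (n i l omega)).
have iterm l : integrable (fun omega => - (2 * mu) * dot (n i l omega) (q i l omega)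
   + mu ^+ 2 * sqn (n i l omega)).
  by apply: integrableDr; apply: integrableZr => //; have [] := sn l.
have ibound : integrable bound.
  by apply: integrableDr; [exact: integrableZr|exact: integrable_fsum].
have dev_le omega : energy (dev i.+1 omega) <= bound omega.
  have := noisy_step_le A1 J A2_ds p_diff2 p_hess mu (fun k => n i k omega)
    (fun l => w i l omega) (x i) s_ge0 sLp_le1.
  rewrite /dev w_step => h; apply: (le_trans h).
  rewrite /bound; apply: le_trans (lerD (q_le omega) (lexx _)).
  rewrite -big_split; apply: ler_sum => k _ /=.
  rewrite -[X in X - mu *: _]/(q i k omega) sqnB sqnZ dotZr dotC.
  by lra.
have idev1 : integrable (fun omega => energy (dev i.+1 omega)).
  apply: (integrable_dominated _ _ ibound) => // omega.
  by rewrite ger0_norm ?energy_ge0.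
split=> //.
have int_phi : \sum_l \int[P]_omega sqn (phi i l omega) <=
    2 * \int[P]_omega energy (dev i omega) + 2 * c.
  have i2 : integrable (fun omega => 2 * energy (dev i omega)) by exact: integrableZr.
  have ic : integrable (fun=> 2 * c) by exact: integrable_const.
  rewrite -Rintegral_fsum; last by move=> l; case: (sphi l).
  have -> : 2 * \int[P]_omega energy (dev i omega) + 2 * c =
      \int[P]_omega (2 * energy (dev i omega) + 2 * c).
    rewrite RintegralD// RintegralZl//; congr (_ + _).
    by rewrite Rintegral_cst// [X in fine X]probability_setT mulr1.
  apply: le_Rintegral => //; last exact: integrableDr.
  by apply: integrable_fsum => l; case: (sphi l).
apply: (le_trans (le_Rintegral measurableT idev1 ibound (fun omega _ => dev_le omega))).
rewrite RintegralD//; last 2 first.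
- exact: integrableZr.
- exact: integrable_fsum.
rewrite RintegralZl// (Rintegral_fsum iterm).
set V := \int[P]_omega energy (dev i omega) in int_phi *.
rewrite [leRHS](_ : _ = (1 - mu * lam) ^+ 2 * V +
  mu ^+ 2 * (alpha * (2 * V + 2 * c) + N%:R * sigma_v2)); last by ring.
rewrite lerD2l.
apply: (@le_trans _ _ (\sum_(l < N) mu ^+ 2 *
   (alpha * \int[P]_omega sqn (phi i l omega) + sigma_v2))).
  apply: ler_sum => l _; rewrite RintegralD//; last 2 first.
  - exact: integrableZr.
  - by apply: integrableZr; have [] := sn l.
  rewrite !RintegralZl//; last by have [] := sn l.
  by rewrite ortho mulr0 add0r ler_wpM2l ?sqr_ge0.
rewrite -mulr_sumr big_split /= -mulr_sumr sumr_const card_ord -[sigma_v2 *+ N]mulr_natl.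
by rewrite ler_wpM2l ?sqr_ge0// lerD2r ler_wpM2l.
Qed.

(** The last condition on mu brings the factor of the recursion below 1 - mu lam. The stationary
    level is then mu^2 K / (mu lam) = mu K / lam. *)
Lemma mean_square_eventually_le c e :
  (forall i, energy (x i) <= c) -> 0 < e -> mu * (lam ^+ 2 + 2 * alpha) <= lam ->
  exists i0, forall i k, (i0 <= i)%N ->
    (second_moment P (fun omega => (wstar - w i k omega)%R) <=
      (2 * (mu * ((2 * alpha * c + N%:R * sigma_v2) / lam) + e) +
       2 * energy (x i - cst wstar))%:E)%E.
Proof.
move=> xc e0 mualpha; set K := 2 * alpha * c + N%:R * sigma_v2.
have init : integrable (fun omega => energy (dev 0 omega)).
  apply: (@integrable_dominated _ _ _ P _
     (fun omega => \sum_k (2 * sqn (w 0 k omega) + 2 * sqn wstar))).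
  - apply: measurable_sum => k; apply: measurable_sqn.
    by apply: vector_measurableB; [exact: w_measurable|exact: vector_measurable_cst].
  - move=> omega; rewrite ger0_norm ?energy_ge0//; apply: ler_sum => k _.
    exact: sqnB_le2.
  - apply: integrable_fsum => k; apply: integrableDr; last exact: integrable_const.
    by apply: integrableZr; case: (w_init k).
have idev i : integrable (fun omega => energy (dev i omega)).
  by elim: i => [//|i IH]; have [] := mean_square_step (xc i) IH.
pose V i := \int[P]_omega energy (dev i omega).
have V0 i : 0 <= V i by apply: Rintegral_ge0 => omega _; exact: energy_ge0.
have q01 : 0 <= 1 - mu * lam < 1.
  by rewrite subr_ge0 (ltW mulam_lt1) gtrBl mulr_gt0.
have Vrec i : V i.+1 <= (1 - mu * lam) * V i + mu ^+ 2 * K.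
  have [_ h] := mean_square_step (xc i) (idev i); apply: (le_trans h).
  rewrite lerD2r; apply: ler_wpM2r; first exact: V0.
  have : mu * (mu * (lam ^+ 2 + 2 * alpha)) <= mu * lam by rewrite ler_wpM2l// ltW.
  by rewrite sqrrB expr1n mul1r exprMn mulr2n; lra.
have [i0 hi0] := affine_recursion_eventually_le q01 e0 Vrec.
exists i0 => i k /hi0 Vi.
have mwk : vector_measurable_fun (fun omega => wstar - w i k omega).
  by apply: vector_measurableB; [exact: vector_measurable_cst|exact: w_measurable].
have wk_le omega : sqn (wstar - w i k omega) <=
    2 * energy (dev i omega) + 2 * energy (x i - cst wstar).
  rewrite sqnBC; apply: (le_trans (sqn_le_energy ((fun l => w i l omega) - cst wstar) k)).
  by rewrite -(subrKA (x i)); exact: energyD_le2.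
have i2 : integrable (fun omega => 2 * energy (dev i omega)) by exact: integrableZr.
have ic : integrable (fun=> 2 * energy (x i - cst wstar)) by exact: integrable_const.
have swk := square_integrable_dominated mwk wk_le (integrableDr i2 ic).
rewrite (second_moment_Rintegral swk) lee_fin.
apply: (le_trans (le_Rintegral measurableT swk.2 (integrableDr i2 ic)
  (fun omega _ => wk_le omega))).
rewrite RintegralD// RintegralZl// Rintegral_cst// [X in fine X]probability_setT mulr1.
rewrite lerD2r ler_wpM2l//; apply: (le_trans Vi).
rewrite lerD2r opprB addrC subrK le_eqVlt; apply/orP; left; apply/eqP.
by field; rewrite !gt_eqF.
Qed.

End MeanSquare.

Lemma diffusion_stepE {R : realType} {M N : nat} (nbr : 'I_N -> {set 'I_N})
    (A1 A2 : 'M[R]_N) (J p : 'I_N -> 'rV[R]_M -> R) (mu eta : R)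
    (v : 'I_N -> 'rV[R]_M -> 'rV[R]_M) (w : 'I_N -> 'rV[R]_M) :
  (forall l k, l \notin nbr k -> A1 l k = 0) ->
  (forall l k, l \notin nbr k -> A2 l k = 0) ->
  diffusion_step nbr A1 A2 J p mu eta v w =
  noisy_step A1 A2 J p mu (mu * eta) (fun k => v k (mix A1 w k)) w.
Proof.
move=> A1_nbr A2_nbr; rewrite /diffusion_step (combineE _ A2_nbr) (combineE _ A1_nbr).
rewrite /noisy_step; apply: (congr1 (mix A2)); apply/funext => l.
by rewrite /penalty_step /gradient_step scalerDr opprD addrA.
Qed.

(** * Weakening of scalar Loewner bounds, used to share constants among the agents *)

Section LoewnerScalar.
Context {R : realType} {M : nat}.
Implicit Types (a b : R) (H : 'M[R]_M).

Let psd_scalar a : 0 <= a -> psd (a%:M : 'M[R]_M).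
Proof.
move=> a0; split=> [|u]; first by rewrite tr_scalar_mx.
by rewrite -/(qform _ u u) qform_scalar mulr_ge0//; exact: sqn_ge0.
Qed.

Let psdD X Y : psd X -> psd Y -> psd (X + Y : 'M[R]_M).
Proof.
move=> [Xs X0] [Ys Y0]; split=> [|u]; first by rewrite linearD /= Xs Ys.
by rewrite mulmxDr mulmxDl mxE addr_ge0.
Qed.

Lemma loewner_le_scalarl a b H : b <= a -> loewner_le a%:M H -> loewner_le b%:M H.
Proof.
move=> ba aH; rewrite /loewner_le.
have -> : H - b%:M = (H - a%:M) + (a - b)%:M by rewrite raddfB /= subrKA.
by apply: psdD => //; apply: psd_scalar; rewrite subr_ge0.
Qed.

Lemma loewner_le_scalarr a b H : a <= b -> loewner_le H a%:M -> loewner_le H b%:M.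
Proof.
move=> ab Ha; rewrite /loewner_le.
have -> : b%:M - H = (b - a)%:M + (a%:M - H) by rewrite raddfB /= subrKA.
by apply: psdD => //; apply: psd_scalar; rewrite subr_ge0.
Qed.

End LoewnerScalar.

(** * Limits superior and convergence to zero in the extended reals *)

Section LimitSuperior.
Context {R : realType}.
Implicit Types (u : nat -> \bar R) (l : R -> \bar R) (a : \bar R).
Local Open Scope ereal_scope.

Lemma limn_esup_le u a : (exists i0, forall i, (i0 <= i)%N -> u i <= a) ->
  limn_esup u <= a.
Proof.
move=> [i0 ua]; apply: (@le_trans _ _ (ereal_sup [set u i | i in [set i | (i0 <= i)%N]])).
  apply: ereal_inf_lbound; exists [set i | (i0 <= i)%N] => //.
  by exists i0.
by apply: ge_ereal_sup => _ [i /= /ua ui <-].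
Qed.

Lemma limn_esup_ge0 u : (forall i, 0 <= u i) -> 0 <= limn_esup u.
Proof.
move=> u0; apply: le_ereal_inf_tmp => _ [V [i0 _ iV] <-].
apply: (le_trans (u0 i0)); apply: ereal_sup_ubound; exists i0 => //.
by apply: iV => /=.
Qed.

Lemma cvge0_nonneg (F : set_system R) {FF : Filter F} l :
  (forall x, 0 <= l x) ->
  (forall e : R, (0 < e)%R -> \forall x \near F, l x <= e%:E) ->
  l x @[x --> F] --> 0.
Proof.
move=> l0 le A [e /= e0 eA].
have e20 : (0 < e / 2)%R by rewrite divr_gt0.
apply: filterS (le _ e20) => x lx.
have lfin : l x \is a fin_num.
  by rewrite ge0_fin_numE// (le_lt_trans lx)// ltry.
move: lx (l0 x); rewrite -(fineK lfin) !lee_fin => lx lx0.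
rewrite /= -(fineK lfin); apply: eA => /=; rewrite sub0r normrN ger0_norm//.
by apply: (le_lt_trans lx); rewrite ltr_pdivrMr// ltr_pMr// ltr1n.
Qed.

End LimitSuperior.

Theorem mainTheorem3 (R : realType) (d : measure_display)
  (Omega : measurableType d) (P : probability Omega R)
  (M N : nat)
  (* network and combination matrices *)
  (nbr : 'I_N -> {set 'I_N}) (nbr_self : forall k, k \in nbr k)
  (A A1 A2 : 'M[R]_N)
  (A_ge0 : forall l k, 0 <= A l k)
  (A_nbr : forall l k, l \notin nbr k -> A l k = 0)
  (A12 : (A1, A2) = (1%:M, A) \/ (A1, A2) = (A, 1%:M))
  (* costs, constraints and penalties *)
  (J : 'I_N -> 'rV[R]_M -> R)
  (J_diff2 : forall k, twice_differentiable (J k))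
  (U L : 'I_N -> nat)
  (h : forall k : 'I_N, 'I_(U k) -> 'rV[R]_M -> R)
  (g : forall k : 'I_N, 'I_(L k) -> 'rV[R]_M -> R)
  (h_affine : forall k u, affine_function (@h k u))
  (g_convex : forall k l, @convex_function R 'rV[R]_M setT (@g k l))
  (dIP dEP : R -> R)
  (dIP_pen : inequality_penalty dIP) (dEP_pen : equality_penalty dEP)
  (p_diff2 : forall k, twice_differentiable (penalty h g dIP dEP k))
  (p_grad0 : forall k w, global_feasible_set h g w ->
     gradient (penalty h g dIP dEP k) w = 0)
  (* (i) *)
  (W_neq0 : global_feasible_set h g !=set0)
  (wstar : 'rV[R]_M)
  (wstar_min :
     minimizer_on (fun w => \sum_(k < N) J k w) (global_feasible_set h g) wstar)
  (* (ii) *)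
  (J_hess : forall k, exists lmin lmax : R, [/\ 0 < lmin, 0 < lmax &
     forall w, loewner_le lmin%:M (hessian (J k) w) /\
               loewner_le (hessian (J k) w) lmax%:M])
  (* (iii) *)
  (p_hess : forall k, exists2 lpmax : R, 0 < lpmax &
     forall w, loewner_le 0 (hessian (penalty h g dIP dEP k) w) /\
               loewner_le (hessian (penalty h g dIP dEP k) w) lpmax%:M)
  (* (iv) *)
  (A_primitive : primitive_mx A) (A_ds : doubly_stochastic A)
  (* the runs of the strategy, one for each step-size *)
  (theta : R) (theta_gt0 : 0 < theta) (theta_lt1 : theta < 1)
  (w0 : R -> 'I_N -> Omega -> 'rV[R]_M)
  (w0_rv : forall mu : R, 0 < mu -> forall k, random_vector (w0 mu k))
  (w0_moment : forall mu : R, 0 < mu -> forall k,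
     (second_moment P (w0 mu k) < +oo)%E)
  (v : R -> nat -> 'I_N -> Omega -> 'rV[R]_M -> 'rV[R]_M)
  (w := fun mu : R =>
     diffusion nbr A1 A2 J (penalty h g dIP dEP) mu (mu `^ (- theta))
               (w0 mu) (v mu))
  (* (v) *)
  (alpha sigma_v2 : R) (alpha_ge0 : 0 <= alpha) (sigma_v2_ge0 : 0 <= sigma_v2)
  (noise : forall mu : R, 0 < mu ->
     gradient_noise_model P (w mu) (v mu) alpha sigma_v2) :
  forall k : 'I_N,
    limn_esup (fun i => second_moment P (fun omega => wstar - w mu i k omega))
      @[mu --> (0 : R)^'+] --> 0%E.
Proof.
move=> k0.
set p := penalty h g dIP dEP in p_diff2 p_grad0 p_hess w noise *.
have [_ _ dIP0 dIP_pos] := dIP_pen.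
have [_ _ dEP0 dEP_pos] := dEP_pen.
have dIP_ge0 t : 0 <= dIP t by case: (leP t 0) => [/dIP0 ->//|/dIP_pos/ltW].
have dEP_ge0 t : 0 <= dEP t by have [->|/dEP_pos/ltW] := eqVneq t 0; rewrite ?dEP0.
have p_ge0 k z : 0 <= p k z by rewrite addr_ge0// sumr_ge0.
(* All summands of a penalty are nonnegative, so its zero set is exactly the feasible set;
   optimality can then be stated with penalties alone. *)
have p_feasible k z : p k z = 0 <-> feasible_set h g k z.
  split=> [/eqP|[hz gz]]; last first.
    rewrite /p /penalty !big1 ?addr0// => i _; first by rewrite hz.
    by rewrite dIP0// gz.
  rewrite paddr_eq0 ?sumr_ge0// !psumr_eq0// => /andP[/allP pg /allP ph].
  split=> [u|l].
    have := ph u (mem_index_enum _); rewrite /=; apply: contraTeq => /dEP_pos.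
    by move=> ?; rewrite gt_eqF.
  have := pg l (mem_index_enum _); rewrite /= leNgt; apply: contraTN => /dIP_pos.
  by move=> ?; rewrite gt_eqF.
have wstar_feasible : global_feasible_set h g wstar by case: wstar_min.
have p_wstar k : p k wstar = 0 by apply/p_feasible.
have p_grad k : gradient (p k) wstar = 0 by exact: p_grad0.
have wstar_opt z : (forall k, p k z = 0) -> \sum_k J k wstar <= \sum_k J k z.
  by move=> pz; apply: wstar_min.2 => k; apply/p_feasible.
have sum_ge (F : 'I_N -> R) : (forall k, 0 < F k) -> forall k, F k <= \sum_l F l.
  move=> F0 k; rewrite (bigD1 k)//= lerDl sumr_ge0// => l _; exact: ltW.
have [lmin [lmax lminmax]] : exists lmin lmax : 'I_N -> R, forall k,
    [/\ 0 < lmin k, 0 < lmax k & forall z, loewner_le (lmin k)%:M (hessian (J k) z) /\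
       loewner_le (hessian (J k) z) (lmax k)%:M].
  have /choice[lmin /choice[lmax lH]] := J_hess.
  by exists lmin, lmax.
have /choice[lpmax lpH] : forall k, exists lp : R, 0 < lp /\
    forall z, loewner_le 0 (hessian (p k) z) /\ loewner_le (hessian (p k) z) lp%:M.
  by move=> k; have [lp lp0 lpH] := p_hess k; exists lp.
(* Constants common to all agents: sums lie above each summand, and the inverse of a sum of inverses
   lies below each [lmin k]. Their positivity uses the agent [k0]. *)
pose lam := (\sum_k (lmin k)^-1)^-1; pose L' := \sum_k lmax k; pose Lp := \sum_k lpmax k.
have lmin0 k : 0 < lmin k by case: (lminmax k).
have lmax0 k : 0 < lmax k by case: (lminmax k).
have lpmax0 k : 0 < lpmax k by case: (lpH k).
have lmini0 k : 0 < (lmin k)^-1 by rewrite invr_gt0.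
have L0 : 0 < L' by exact: lt_le_trans (sum_ge lmax lmax0 k0).
have Lp0 : 0 < Lp by exact: lt_le_trans (sum_ge lpmax lpmax0 k0).
have lami0 : 0 < \sum_k (lmin k)^-1.
  exact: lt_le_trans (sum_ge (fun k => (lmin k)^-1) lmini0 k0).
have lam0 : 0 < lam by rewrite invr_gt0.
have J_hess' k z : loewner_le lam%:M (hessian (J k) z) /\
    loewner_le (hessian (J k) z) L'%:M.
  have [_ _ /(_ z)[h1 h2]] := lminmax k; split.
    apply: loewner_le_scalarl h1; rewrite /lam -[leRHS]invrK lef_pV2 ?posrE//.
    exact: (sum_ge (fun k => (lmin k)^-1)).
  by apply: loewner_le_scalarr h2; exact: sum_ge.
have p_hess' k z : loewner_le 0%:M (hessian (p k) z) /\
    loewner_le (hessian (p k) z) Lp%:M.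
  have [_ /(_ z)[h1 h2]] := lpH k; split; first by rewrite raddf0.
  by apply: loewner_le_scalarr h2; exact: sum_ge.
have [_ _ A_col] := A_ds.
have A12_ds : doubly_stochastic A1 /\ doubly_stochastic A2.
  by case: A12 => -[-> ->]; split => //; exact: doubly_stochastic1.
have [A1_ds A2_ds] := A12_ds.
have I_nbr l k : l \notin nbr k -> (1%:M : 'M[R]_N) l k = 0.
  by rewrite mxE; case: eqVneq => // ->; rewrite nbr_self.
have A12_nbr : (forall l k, l \notin nbr k -> A1 l k = 0) /\
    (forall l k, l \notin nbr k -> A2 l k = 0).
  by case: A12 => -[-> ->].
have consensus (x : 'I_N -> 'rV[R]_M) : mix A2 (mix A1 x) = x -> forall k l, x k = x l.
  move=> xfix; apply: (primitive_fixed_consensus A_primitive A_ge0 A_col).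
  by move: xfix; case: A12 => -[-> ->]; rewrite mix1.
(* Energy bound of the noise-free run about the origin: twice the squared radius of the ball around
   [wstar], plus twice the energy of [wstar]. *)
pose c := 4 * J_residual J wstar / lam ^+ 2 + 2 * energy (cst wstar : 'I_N -> 'rV[R]_M).
apply: cvge0_nonneg => [mu|e e0].
  by apply: limn_esup_ge0 => i; apply: expectation_ge0 => omega; exact: sqr_ge0.
(* Three errors of size e / 8 enter the final bound, each doubled, for a total of 6 e / 8. *)
have e80 : 0 < e / 8 by rewrite divr_gt0.
have [tau tau0 close] := noise_free_run_close A1_ds A2_ds consensus lam0 L0 Lp0 J_diff2
  p_diff2 J_hess' p_hess' p_grad p_wstar p_ge0 wstar_opt e80.
pose K := (2 * alpha * c + N%:R * sigma_v2) / lam.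
have theta1 : 0 < 1 - theta by rewrite subr_gt0.
have powR_small (a t : R) : 0 < a -> 0 < t -> \forall mu \near (0 : R)^'+, mu `^ a <= t.
  move=> a0 t0; have /cvgrPdist_le/(_ _ t0) := powR_cvg0 a0.
  apply: filterS => mu; rewrite sub0r normrN; apply: le_trans; exact: ler_norm.
have small (a t : R) : 0 <= a -> 0 < t -> \forall mu \near (0 : R)^'+, mu * a <= t.
  move=> a0 t0; have ta : 0 < t / (a + 1) by rewrite divr_gt0// ltr_wpDl.
  near=> mu; have mu0 : 0 < mu by near: mu; exact: nbhs_right_gt.
  apply: (@le_trans _ _ (mu * (a + 1))); first by rewrite ler_pM2l// lerDl.
  rewrite -ler_pdivlMr ?ltr_wpDl//; near: mu; exact: nbhs_right_le.
have c0 : 0 <= c.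
  apply: addr_ge0; last by rewrite mulr_ge0// energy_ge0.
  by apply: divr_ge0; [rewrite mulr_ge0// J_residual_ge0|exact: sqr_ge0].
have K0 : 0 <= K.
  by apply: divr_ge0; [apply: addr_ge0; rewrite !mulr_ge0|exact: ltW].
near=> mu.
have mu0 : 0 < mu by near: mu; exact: nbhs_right_gt.
have eta0 : 0 < mu `^ (- theta) by rewrite powR_gt0.
(* The only use of the exponent: mu * eta is mu^(1 - theta) and 1 / eta is mu^theta, and both tend
   to zero since 0 < theta < 1. *)
have mueta : mu * mu `^ (- theta) = mu `^ (1 - theta).
  by rewrite -{1}(powRr1 (ltW mu0)) -powRD// (gt_eqF mu0) implybT.
have mutau : mu <= tau by near: mu; exact: nbhs_right_le.
have stau : mu * mu `^ (- theta) <= tau by rewrite mueta; near: mu; exact: powR_small.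
have etatau : (mu `^ (- theta))^-1 <= tau.
  by rewrite powRN invrK; near: mu; exact: powR_small.
have mualpha : mu * (lam ^+ 2 + 2 * alpha) <= lam.
  by near: mu; apply: small => //; rewrite addr_ge0 ?sqr_ge0 ?mulr_ge0.
have muK : mu * K <= e / 8 by near: mu; exact: small.
have [muL mulam sLp [i1 hi1]] := close mu _ mu0 mutau eta0 stau etatau.
have s0 : 0 <= mu * mu `^ (- theta) by rewrite mulr_ge0// ltW.
have w_init k : square_integrable P (w mu 0 k).
  by apply: second_moment_square_integrable; [exact: w0_rv|exact: w0_moment].
have w_step i omega : (fun k => w mu i.+1 k omega) =
    noisy_step A1 A2 J p mu (mu * mu `^ (- theta))
      (fun k => v mu i.+1 k omega (mix A1 (fun l => w mu i l omega) k))
      (fun l => w mu i l omega).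
  have H := diffusion_stepE J p mu (mu `^ (- theta)) (fun l => v mu i.+1 l omega)
    (fun l => w mu i l omega) A12_nbr.1 A12_nbr.2.
  by apply/funext => k; exact: (congr1 (@^~ k) H).
have xc i : energy (noise_free_run A1 A2 J p wstar mu (mu * mu `^ (- theta)) i) <= c.
  have b := noise_free_run_bounded A1_ds A2_ds lam0 J_diff2 p_diff2 J_hess' p_hess' p_grad
    i mu0 muL mulam s0 sLp.
  rewrite -(subrK (cst wstar) (noise_free_run _ _ _ _ _ _ _ i)).
  apply: (le_trans (energyD_le2 _ _)); rewrite /c lerD2r.
  by move: b; lra.
have [i2 hi2] := mean_square_eventually_le A1_ds A2_ds lam0 J_diff2 p_diff2 J_hess' p_hess'
  mu0 s0 alpha_ge0 muL mulam sLp w_init (noise mu mu0) w_step xc e80 mualpha.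
apply: limn_esup_le; exists (maxn i1 i2) => i; rewrite geq_max => /andP[/hi1 h1 /hi2 h2].
apply: (le_trans (h2 k0)); rewrite lee_fin.
by move: muK h1; rewrite /K; lra.
Unshelve. all: by end_near. Qed.
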